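(* Let $A\in\mathcal{L}(X,Y)$, let $y=Ax+\varepsilon$, where $x$ is a square-integrable $X$-valued random variable and $\varepsilon$ is a zero-mean square-integrable $Y$-valued random variable, independent of $x$, with injective covariance operator $\Sigma_\varepsilon$, and let $\rho$ be the joint distribution of $(x,y)$. Assume that the compatibility assumption between $\Sigma_\varepsilon$ and $A$ holds, that $\mathcal{B}\subset\mathcal{L}(\ell^2,X)$ is a nonempty compact set such that $AB$ is finite basis injective for every $B\in\mathcal{B}$, and that there exists $Q_0>0$ such that $\|x\|_X\le Q_0$ and $\|\varepsilon\|_Y\le Q_0$ almost surely. Assume further that there are constants $C,s>0$ such that $$\log\big(\mathcal{N}(\mathcal{B},r)\big)\le C r^{-1/s}\qquad\text{for all } r>0.$$ Let $\{(x_j,y_j)\}_{j=1}^m$ be i.i.d. samples from $\rho$, let $B^\star$ be a minimizer of $L$ over $\mathcal{B}$ and $\widehat B$ a minimizer of $\widehat L$ over $\mathcal{B}$. Then there exist $\alpha_1,\alpha_2>0$, depending only on $A$, $\mathcal{B}$, $\Sigma_\varepsilon$ and $Q_0$, such that for every $\tau>0$ and all sufficiently large $m$, $$\mathbb{P}\left[L(\widehat B)-L(B^\star)\le\left(\frac{\alpha_1+\alpha_2\sqrt{\tau}}{\sqrt m}\right)^{1-\frac{1}{1+2s}}\right]\ge 1-e^{-\tau},$$ where $\mathbb{P}$ is the probability with respect to the sample.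
   Context: $X,Y$ are real separable Hilbert spaces; $\mathcal{L}(\cdot,\cdot)$ denotes bounded linear operators with the operator norm (compactness of $\mathcal{B}$ is with respect to this norm); $\ell^2=\ell^2(\mathbb{N})$ with $\mathbb{N}=\{1,2,\dots\}$ and canonical basis $(e_i)$. $\Sigma_\varepsilon^{-1}$ and $\Sigma_\varepsilon^{-1/2}$ denote the (possibly unbounded) inverses of $\Sigma_\varepsilon$ and $\Sigma_\varepsilon^{1/2}$, defined on $\operatorname{Im}(\Sigma_\varepsilon)$ and $\operatorname{Im}(\Sigma_\varepsilon^{1/2})$ respectively. Compatibility assumption: $\operatorname{Im}(A)\subset\operatorname{Im}(\Sigma_\varepsilon)$ and $\Sigma_\varepsilon^{-1}A\colon X\to Y$ is a compact operator. Finite basis injectivity of $AB$: for every finite $I\subset\mathbb{N}$, the restriction of $AB$ to $\ell^2_I:=\operatorname{span}\{e_i:i\in I\}$ is injective. Reconstruction map: $R_B(y)=B\hat u_B(y)$, where $\hat u_B(y)\in\ell^2$ is the unique minimizer over $u\in\ell^2$ of $\frac12\|\Sigma_\varepsilon^{-1/2}ABu\|_Y^2-\langle y,\Sigma_\varepsilon^{-1}ABu\rangle_Y+\|u\|_{\ell^1}$ (with $\|u\|_{\ell^1}=+\infty$ for $u\in\ell^2\setminus\ell^1$); existence and uniqueness hold for every $y\in Y$ and every $B\in\mathcal{L}(\ell^2,X)$ such that $AB$ is finite basis injective, whenever $A\in\mathcal{L}(X,Y)$, $\Sigma_\varepsilon$ is the injective covariance operator of a zero-mean square-integrable $Y$-valued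 random variable, $\operatorname{Im}(A)\subset\operatorname{Im}(\Sigma_\varepsilon)$ and $\Sigma_\varepsilon^{-1}A\colon X\to Y$ is compact. Losses: $L(B)=\mathbb{E}_{(x,y)\sim\rho}\big[\|R_B(y)-x\|_X^2\big]$ and $\widehat L(B)=\frac1m\sum_{j=1}^m\|R_B(y_j)-x_j\|_X^2$. A minimizer $B^\star$ of $L$ over $\mathcal{B}$ exists, and a minimizer $\widehat B$ of $\widehat L$ over $\mathcal{B}$ exists with probability $1$; $\widehat B$ depends on the sample. Covering number: for $r>0$, $\mathcal{N}(\mathcal{B},r)$ is the minimum number of balls of radius $r$ (in the operator norm of $\mathcal{L}(\ell^2,X)$) whose union contains $\mathcal{B}$. *)

(* Defs.v *)
From HB Require Import structures.
From mathcomp Require Import all_boot all_order all_algebra finmap.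
From mathcomp Require Import all_classical all_reals all_analysis.

Set Implicit Arguments.
Unset Strict Implicit.
Unset Printing Implicit Defensive.

Import Order.TTheory GRing.Theory Num.Theory.
Import numFieldNormedType.Exports.

Local Open Scope classical_set_scope.
Local Open Scope ring_scope.

HB.mixin Record isHilbert (R : realType) X & CompleteNormedModule R X := {
  inner : {dot X for (@idfun R)} ;
  norm_inner : forall x : X, `|x| ^+ 2 = inner x x }.

#[short(type=hilbertType)]
HB.structure Definition Hilbert (R : realType) :=
  {X of isHilbert R X & CompleteNormedModule R X}.

Definition separable (T : topologicalType) :=
  exists2 D : set T, countable D & dense D.

Definition borel (T : ptopologicalType) := g_sigma_algebraType (@open T).
HB.instance Definition _ (T : ptopologicalType) :=
  Measurable.on (borel T).

Section bounded_operators.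
Context (R : realType) (V W : normedModType R).

Definition bounded_linear : {pred V -> W} :=
  [pred f | `[< linear f /\ exists k, forall x, `|f x| <= k * `|x| >]].

Record bop := Bop { bop_fun :> V -> W ; _ : bop_fun \in bounded_linear }.

HB.instance Definition _ := [isSub for bop_fun].
HB.instance Definition _ := [Choice of bop by <:].

Lemma bounded_linear_submod_closed : submod_closed bounded_linear.
Proof.
split.
  rewrite inE; split=> [a x y|].
    by rewrite /= scaler0 addr0.
  by exists 0 => x; rewrite normr0 mul0r.
move=> a f g; rewrite !inE => -[fl [k fk]] [gl [l gl']]; split.
  move=> b x y; rewrite !fctE fl gl.
  by rewrite !scalerDr !scalerA (mulrC a b) addrACA.
exists (`|a| * k + l) => x; rewrite !fctE (le_trans (ler_normD _ _))//.
rewrite mulrDl lerD// normrZ -mulrA ler_wpM2l//; exact: fk.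
Qed.

HB.instance Definition _ :=
  GRing.isSubmodClosed.Build _ _ bounded_linear bounded_linear_submod_closed.
HB.instance Definition _ := [SubChoice_isSubLmodule of bop by <:].

Lemma bop_linear (f : bop) : linear f.
Proof. by case: f => f /= /asboolP[]. Qed.

HB.instance Definition _ (f : bop) :=
  GRing.isLinear.Build R V W *:%R (bop_fun f) (bop_linear f).

Definition opnorm (f : bop) : R :=
  sup [set `|f x| | x in [set x : V | `|x| <= 1]].

Lemma opnorm_has_sup (f : bop) :
  has_sup [set `|f x| | x in [set x : V | `|x| <= 1]].
Proof.
split; first by exists `|f 0|, 0 => //=; rewrite normr0.
have [k fk] : exists k, forall x, `|f x| <= k * `|x|.
  by case: f => f /= /asboolP[].
exists `|k| => _ [x /= x1 <-]; apply: (le_trans (fk x)).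
rewrite (le_trans (ler_norm _))// normrM normr_id.
by rewrite -[leRHS]mulr1 ler_wpM2l.
Qed.

Lemma opnorm_unit_ub (f : bop) x : `|x| <= 1 -> `|f x| <= opnorm f.
Proof. by move=> x1; apply: (sup_upper_bound (opnorm_has_sup f)); exists x. Qed.

Lemma opnorm_le (f : bop) k :
  (forall x, `|x| <= 1 -> `|f x| <= k) -> opnorm f <= k.
Proof.
move=> fk; apply: ge_sup; first by case: (opnorm_has_sup f).
by move=> _ [x /= x1 <-]; exact: fk.
Qed.

Lemma opnormD (f g : bop) : opnorm (f + g) <= opnorm f + opnorm g.
Proof.
apply: opnorm_le => x x1; apply: le_trans (ler_normD _ _) _.
by rewrite lerD ?opnorm_unit_ub.
Qed.

Lemma opnormZ_le (a : R) (f : bop) : opnorm (a *: f) <= `|a| * opnorm f.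
Proof.
apply: opnorm_le => x x1; rewrite [leLHS]normrZ.
by rewrite ler_wpM2l// opnorm_unit_ub.
Qed.

Lemma opnorm_ge0 (f : bop) : 0 <= opnorm f.
Proof.
by apply: le_trans (opnorm_unit_ub f (x := 0) _); rewrite ?normr0.
Qed.

Lemma opnormZ (a : R) (f : bop) : opnorm (a *: f) = `|a| * opnorm f.
Proof.
apply/eqP; rewrite eq_le opnormZ_le /=.
have [->|a0] := eqVneq a 0; first by rewrite normr0 mul0r opnorm_ge0.
rewrite -ler_pdivlMl ?normr_gt0//.
have := opnormZ_le a^-1 (a *: f).
by rewrite scalerA mulVf// scale1r normfV.
Qed.

Lemma opnorm0_eq0 (f : bop) : opnorm f = 0 -> f = 0.
Proof.
move=> f0; apply/val_inj/funext => x; apply/eqP.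
rewrite -normr_le0 -[\val f]/(bop_fun f).
have [->|x0] := eqVneq x 0; first by rewrite linear0 normr0.
have := opnorm_unit_ub f (x := `|x|^-1 *: x).
rewrite f0 linearZ /= !normrZ normfV normr_id mulVf ?normr_eq0//.
by move=> /(_ (lexx _)); rewrite pmulr_rle0// invr_gt0 normr_gt0.
Qed.

HB.instance Definition _ :=
  Lmodule_isNormed.Build R bop opnormD opnormZ opnorm0_eq0.

End bounded_operators.

(** [l2 R] is L^2 of the counting measure on [nat]. Indices start at 0. *)
Section l2.
Context (R : realType).
Local Notation counting := (@counting nat R).

Definition l2 : Type := LfunType counting (lee1n 2).

HB.instance Definition _ := GRing.Lmodule.on l2.

Definition l2norm (u : l2) : R := fine ('N[counting]_2%:E[EFin \o u])%E.

Lemma l2normZ (a : R) (u : l2) : l2norm (a *: u) = `|a| * l2norm u.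
Proof.
rewrite /l2norm; have -> : EFin \o (a *: u : l2) = EFin \o (a \*: u) by [].
by rewrite LnormZ fineM// -finite_norm_fine.
Qed.

Lemma l2norm0_eq0 (u : l2) : l2norm u = 0 -> u = 0.
Proof.
move=> /(@fine_Lnormr_eq0 _ _ R counting _ (lee1n 2)) [N [mN N0 uN]].
apply/LfuneqP => i; apply: contrapT => ui.
have Ni : N i by apply: uN => /= /(_ I).
have : (counting [set i] <= counting N)%E.
  by apply: le_measure; rewrite ?inE// => _ ->.
rewrite N0 /counting/= /mscale; case: asboolP => [_|]; last first.
  by move=> /(_ (finite_set1 _)).
by rewrite fset_set1 cardfs1 lee_fin ler10.
Qed.

HB.instance Definition _ := Lmodule_isNormed.Build R l2
  (@ler_LnormD _ _ R counting _ (lee1n 2)) l2normZ l2norm0_eq0.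

Section basis.
Variable i : nat.

Definition l2delta (j : nat) : R := (j == i)%:R.

Lemma l2delta_measurable : measurable_fun [set: nat] l2delta.
Proof. by []. Qed.

Lemma l2delta_finite : finite_norm counting 2%:E l2delta.
Proof.
rewrite /finite_norm Lnorm_counting//.
rewrite (@nneseriesD1 _ _ i)//; last first.
  by move=> k _; rewrite poweR_ge0.
rewrite eseries0 => [|k _ /= /negbTE ki]; last first.
  by rewrite /l2delta ki normr0 powR0.
by rewrite adde0 /= /l2delta eqxx normr1 !(powR1, poweR1r) ltry.
Qed.

HB.instance Definition _ := isMeasurableFun.Build _ _ _ _ l2delta
  l2delta_measurable.
HB.instance Definition _ := isLfunction.Build _ _ R counting _ (lee1n 2) l2delta
  l2delta_finite.

Definition l2e : l2 := [the LfunType counting (lee1n 2) of l2delta].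

End basis.

Definition l2_span (I : {fset nat}) : set l2 :=
  [set \sum_(i <- I) c i *: l2e i | c in [set: nat -> R]].

Definition l1norm (u : l2) : \bar R := (\sum_(0 <= i <oo) `|u i|%:E)%E.

End l2.

Section operators.
Context (R : realType).

Definition finite_basis_injective (V : normedModType R) (f : l2 R -> V) :=
  forall I : {fset nat}, set_inj (l2_span I) f.

Definition compact_operator (V W : normedModType R) (f : V -> W) :=
  linear f /\ precompact (f @` [set x | `|x| <= 1]).

Definition is_sqrt_op (Y : hilbertType R) (T S : bop Y Y) :=
  [/\ forall u v, inner (S u) v = inner u (S v),
      forall u, 0 <= inner (S u) u
    & forall u, S (S u) = T u].

(* Bounded positive self-adjoint operators have exactly one such root. *)
Definition sqrt_op (Y : hilbertType R) (T : bop Y Y) : bop Y Y :=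
  get [set S | is_sqrt_op T S].

(* Meaningful on the range of an injective [T] only; junk values outside it. *)
Definition op_inv (V W : normedModType R) (T : bop V W) (y : W) : V :=
  get [set x | T x = y].

End operators.

Definition minimizes (T : Type) (d : Order.disp_t) (O : porderType d)
    (J : T -> O) (S : set T) (b : T) :=
  S b /\ forall c, S c -> (J b <= J c)%O.

Section covering.
Context (R : realType) (V : normedModType R).

Definition covered_by (S : set V) (r : R) (n : nat) :=
  exists c : 'I_n -> V, S `<=` \bigcup_i ball (c i) r.

(* The minimum exists as soon as [S] is totally bounded and [0 < r]. *)
Definition covering_number (S : set V) (r : R) : nat :=
  get [set n | covered_by S r n /\ forall k, covered_by S r k -> (n <= k)%N].

End covering.

Section reconstruction.
Context (R : realType) (X Y : hilbertType R) (A : bop X Y) (Sigma : bop Y Y).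

Definition objective (B : bop (l2 R) X) (y : Y) (u : l2 R) : \bar R :=
  ((2^-1 * `|op_inv (sqrt_op Sigma) (A (B u))| ^+ 2
    - inner y (op_inv Sigma (A (B u))))%:E + l1norm u)%E.

(* [get] selects the minimizer, which exists and is unique under the
   compatibility and finite basis injectivity assumptions. *)
Definition uhat (B : bop (l2 R) X) (y : Y) : l2 R :=
  get [set u | minimizes (objective B y) setT u].

Definition reconstruct (B : bop (l2 R) X) (y : Y) : X := B (uhat B y).

Definition risk (rho : probability (borel X * borel Y)%type R)
    (B : bop (l2 R) X) : \bar R :=
  'E_rho[(fun z => `|reconstruct B z.2 - (z.1 : X)| ^+ 2)%R]%E.

Definition empirical_risk (m : nat) (z : 'I_m -> X * Y)
    (B : bop (l2 R) X) : R :=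
  m%:R^-1 * \sum_(j < m) `|reconstruct B (z j).2 - (z j).1| ^+ 2.

End reconstruction.

Section random_vectors.
Context (R : realType) (d : measure_display) (Omega : measurableType d).
Variable P : probability Omega R.

Definition random_vector (V : ptopologicalType) (f : Omega -> V) :=
  measurable_fun [set: Omega] (f : Omega -> borel V).

Definition square_integrable (V : normedModType R) (f : Omega -> V) :=
  random_vector f /\ (\int[P]_w (`|f w| ^+ 2)%:E < +oo)%E.

(* The expectation of [f] is characterized by duality: the vector [mu] with
   E<f, v> = <mu, v> for all v. *)
Definition zero_mean (V : hilbertType R) (f : Omega -> V) :=
  forall v : V, ('E_P[(fun w => inner (f w) v)%R] = 0)%E.

Definition is_covariance_operator (V : hilbertType R) (f : Omega -> V)
    (S : bop V V) :=
  forall u v : V,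
    covariance P (fun w => inner (f w) u) (fun w => inner (f w) v)
    = (inner (S u) v)%:E.

Definition independent_rv (V W : ptopologicalType) (f : Omega -> V)
    (g : Omega -> W) :=
  forall (E : set (borel V)) (F : set (borel W)),
    measurable E -> measurable F ->
    P ((f @^-1` E) `&` (g @^-1` F)) = (P (f @^-1` E) * P (g @^-1` F))%E.

Definition has_law (d' : measure_display) (U : measurableType d')
    (f : Omega -> U) (mu : probability U R) :=
  measurable_fun [set: Omega] f /\
  forall E : set U, measurable E -> P (f @^-1` E) = mu E.

Definition iid_sample (d' : measure_display) (U : measurableType d') (m : nat)
    (z : 'I_m -> Omega -> U) (mu : probability U R) :=
  (forall j, has_law (z j) mu) /\
  forall (J : {set 'I_m}) (E : 'I_m -> set U), (forall j, measurable (E j)) ->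
    P (\bigcap_(j in [set` J]) (z j @^-1` E j))
    = (\prod_(j in J) P (z j @^-1` E j))%E.

End random_vectors.

(* Main.v *)
Require Import Defs.
From HB Require Import structures.
From mathcomp Require Import all_boot all_order all_algebra finmap.
From mathcomp Require Import all_classical all_reals all_analysis.
From mathcomp Require Import measurable_realfun.
From mathcomp Require Import ring lra.

Import Order.TTheory GRing.Theory Num.Theory.
Import numFieldNormedType.Exports.

Local Open Scope classical_set_scope.
Local Open Scope ring_scope.

(** The minimizers are sparse: since [Sigma^-1 A] is compact, the images
    [Sigma^-1 A B e_i] tend to [0] uniformly in [B] in [Bset], so that dropping
    the coordinates of large index lowers the objective. All minimizers, for [B]
    in [Bset] and bounded data, thus live in one finite-dimensional coordinate
    space of [l2], on which finite basis injectivity and compactness of [Bset] make the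
    quadratic part uniformly strongly convex. Hence [(B, y) |-> R_B y] is
    Lipschitz, and the loss is almost surely bounded and Lipschitz in [B].
    Hoeffding-type concentration at the centers of an [r]-covering of [Bset] and
    a union bound control the excess risk by a multiple of [r + t]; both terms
    are balanced at the order [sqrt m ^ (- 2 s / (1 + 2 s))]. *)

(** * Hilbert spaces and square roots of positive operators *)

(** The linear term is the difficulty of the variational part: [y] need not lie in the range of
    Sigma^(1/2), so <y, Sigma^-1 A B u> is not controlled by the quadratic term alone. Compactness
    of Sigma^-1 A gives an interpolation inequality that splits this term into a small multiple of
    |u|, absorbed by the l1 norm, and a multiple of |Sigma^(-1/2) A B u|. Concentration is made
    elementary by rounding the loss to a finite grid: independence is then applied only to the grid
    cells, and the exponential moment bound becomes a finite sum. The order of the quantifiers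
    shapes the end. [alpha1] and [alpha2] are fixed before [C], [s] and the law of the data, so the
    stability constants must be uniform over all laws with the given bound, and [C] may enter only
    through the best exponent of [Bset]; [tau] is absorbed in the threshold on [m]. As the empirical
    minimizer is an arbitrary function of the sample, its probability bound is stated through a
    measurable event inside the desired one. *)

Section inner_product.
Context {R : realType} {X : hilbertType R}.
Implicit Types u v w : X.

Lemma innerC u v : inner u v = inner v u.
Proof. by rewrite hermC /= expr0 mul1r. Qed.

Lemma innerDl u v w : inner (u + v) w = inner u w + inner v w.
Proof. exact: linearDl. Qed.

Lemma innerDr u v w : inner w (u + v) = inner w u + inner w v.
Proof. exact: linearDr. Qed.

Lemma innerBl u v w : inner (u - v) w = inner u w - inner v w.
Proof. exact: linearBl. Qed.

Lemma innerBr u v w : inner w (u - v) = inner w u - inner w v.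
Proof. exact: linearBr. Qed.

Lemma innerZl a u v : inner (a *: u) v = a * inner u v.
Proof. exact: linearZl_LR. Qed.

Lemma innerZr a u v : inner u (a *: v) = a * inner u v.
Proof. by rewrite innerC innerZl innerC. Qed.

End inner_product.


(** Stated for semidefinite forms, because it is applied to [inner (N u) v] with [N] positive but
    possibly not injective. *)
Lemma cauchy_schwarz_form {R : realType} {V : lmodType R} (f : V -> V -> R)
    (fC : forall u v, f u v = f v u)
    (fD : forall u v w, f (u + v) w = f u w + f v w)
    (fZ : forall a u w, f (a *: u) w = a * f u w)
    (f0 : forall u, 0 <= f u u) u v :
  f u v ^+ 2 <= f u u * f v v.
Proof.
have fexp a b : 0 <= a ^+ 2 * f u u + 2 * a * b * f u v + b ^+ 2 * f v v.
  have := f0 (a *: u + b *: v).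
  rewrite fD !fZ [f u (_ + _)]fC [f v (_ + _)]fC !fD !fZ (fC v u).
  by congr (_ <= _); ring.
have [fv0|fv0] := eqVneq (f v v) 0; last first.
  (* This choice of coefficients makes the quadratic expression equal to [f v v] times the gap in
     the inequality. *)
  have := fexp (f v v) (- f u v); have := f0 v.
  rewrite le_eqVlt eq_sym (negbTE fv0)/= => fv.
  rewrite (_ : _ + _ = f v v * (f u u * f v v - f u v ^+ 2)); last by ring.
  by rewrite pmulr_rge0// subr_ge0.
have [fu0|fu0] := eqVneq (f u u) 0; last first.
  have := fexp (- f u v) (f u u); have := f0 u.
  rewrite le_eqVlt eq_sym (negbTE fu0)/= => fu.
  rewrite (_ : _ + _ = f u u * (f u u * f v v - f u v ^+ 2)); last by ring.
  by rewrite pmulr_rge0// subr_ge0.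
(* When both diagonal values vanish, this instance reads [0 <= - 2 * f u v ^+ 2]. *)
by have := fexp 1 (- f u v); rewrite fu0 fv0; nra.
Qed.

Lemma cauchy_schwarz {R : realType} {X : hilbertType R} (u v : X) :
  `|inner u v| <= `|u| * `|v|.
Proof.
rewrite -ler_sqr ?nnegrE ?mulr_ge0//.
rewrite -normrX ger0_norm ?sqr_ge0// exprMn !norm_inner.
apply: cauchy_schwarz_form => [u' v'|u' v' w|a u' w|u'].
- exact: innerC.
- exact: innerDl.
- exact: innerZl.
- by rewrite -norm_inner sqr_ge0.
Qed.

Section bounded_operators.
Context {R : realType} {V W : normedModType R}.

Lemma bop_norm_le (f : bop V W) x : `|f x| <= `|f| * `|x|.
Proof.
have [->|x0] := eqVneq x 0; first by rewrite linear0 !normr0 mulr0.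
have nx : 0 < `|x| by rewrite normr_gt0.
have := opnorm_unit_ub f (x := `|x|^-1 *: x).
rewrite linearZ/= !normrZ normfV normr_id mulVf ?gt_eqF// lexx => /(_ isT).
by rewrite ler_pdivrMl// mulrC.
Qed.

Lemma bopB (f g : bop V W) x : (f - g) x = f x - g x.
Proof. by []. Qed.

Lemma bopZr (f : bop V W) a x : f (a *: x) = a *: f x.
Proof. exact: linearZ_LR. Qed.

Lemma bopDr (f : bop V W) x y : f (x + y) = f x + f y.
Proof. exact: linearD. Qed.

Lemma bopBr (f : bop V W) x y : f (x - y) = f x - f y.
Proof. exact: linearB. Qed.

Lemma bop_sum (f : bop V W) (I : Type) (r : seq I) (P : pred I) (F : I -> V) :
  f (\sum_(i <- r | P i) F i) = \sum_(i <- r | P i) f (F i).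
Proof. exact: linear_sum. Qed.

Lemma bop_continuous (f : bop V W) : continuous f.
Proof.
apply: bounded_linear_continuous; apply/linear_boundedP.
near=> k => x; apply: (le_trans (bop_norm_le f x)).
by rewrite ler_wpM2r//; near: k; exact: nbhs_pinfty_ge (num_real _).
Unshelve. all: by end_near. Qed.

Lemma bounded_linearP (f : V -> W) k : linear f ->
  (forall x, `|f x| <= k * `|x|) -> exists g : bop V W, f = g.
Proof.
move=> lf fk; have fb : f \in @bounded_linear R V W.
  by rewrite inE; split=> //; exists k.
by exists (Bop fb).
Qed.

End bounded_operators.

Section composition.
Context {R : realType} {U V W : normedModType R} (f : bop V W) (g : bop U V).

Lemma bop_comp_bounded_linear : f \o g \in @bounded_linear R U W.
Proof.
rewrite inE; split=> [a x y /=|]; first by rewrite bopDr bopZr bopDr bopZr.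
exists (`|f| * `|g|) => x /=; rewrite (le_trans (bop_norm_le _ _))//.
by rewrite -mulrA ler_wpM2l// bop_norm_le.
Qed.

Definition bop_comp : bop U W := Bop bop_comp_bounded_linear.

End composition.

Lemma inner_continuous {R : realType} {X : hilbertType R} (v : X) :
  continuous (fun u : X => inner u v).
Proof.
have [g ->] : exists g : bop X R^o, (fun u => inner u v) = g.
  apply: (@bounded_linearP _ _ _ _ `|v|) => [a x y|x].
    by rewrite innerDl innerZl.
  by rewrite mulrC; exact: cauchy_schwarz.
exact: bop_continuous.
Qed.

Section square_root.
Context {R : realType} {Y : hilbertType R}.

(* A fixed point of [Z = (N + Z^2) / 2] satisfies [(1 - Z)^2 = 1 - N]; the iterates
   from [0] are dominated by those of the scalar equation with [N = 1]. *)
Fixpoint sqrt_majorant (n : nat) : R :=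
  if n is k.+1 then 2^-1 * (1 + sqrt_majorant k ^+ 2) else 0.

Fixpoint sqrt_iter (N : Y -> Y) (n : nat) (u : Y) : Y :=
  if n is k.+1 then 2^-1 *: (N u + sqrt_iter N k (sqrt_iter N k u)) else 0.

Lemma sqrt_majorant_itv n : 0 <= sqrt_majorant n <= 1.
Proof. by elim: n => [|n /andP[]] /=; [rewrite lexx ler01|nra]. Qed.

Lemma sqrt_majorant_le n : sqrt_majorant n <= sqrt_majorant n.+1.
Proof.
elim: n => [/=|n]; first by nra.
have := sqrt_majorant_itv n; have := sqrt_majorant_itv n.+1.
by move=> /= /andP[? ?] /andP[? ?] ?; nra.
Qed.

Variable N : Y -> Y.
Hypothesis N_linear : linear N.
Hypothesis N_sym : forall u v, inner (N u) v = inner u (N v).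
Hypothesis N_le : forall u, `|N u| <= `|u|.

Local Notation Z := (sqrt_iter N).

Lemma sqrt_iterS n u : Z n.+1 u = 2^-1 *: (N u + Z n (Z n u)).
Proof. by []. Qed.

Lemma sqrt_iter_linear n : linear (Z n).
Proof.
elim: n => [|n ih] a u v /=; first by rewrite scaler0 addr0.
rewrite N_linear !ih scalerA mulrC -scalerA -scalerDr; congr (_ *: _).
by rewrite scalerDr addrACA.
Qed.

Lemma sqrt_iterB n u v : Z n (u - v) = Z n u - Z n v.
Proof.
by rewrite addrC -scaleN1r sqrt_iter_linear scaleN1r addrC.
Qed.

Lemma sqrt_iter_sym n u v : inner (Z n u) v = inner u (Z n v).
Proof.
elim: n u v => [|n ih] u v /=; first by rewrite linear0l linear0r.
by rewrite innerZl innerZr innerDl innerDr N_sym !ih.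
Qed.

Lemma sqrt_iter_le n u : `|Z n u| <= sqrt_majorant n * `|u|.
Proof.
elim: n u => [|n ih] u /=; first by rewrite normr0 mul0r.
rewrite normrZ ger0_norm// -mulrA ler_pM2l//.
rewrite (le_trans (ler_normD _ _))// mulrDl mul1r lerD//.
rewrite (le_trans (ih _))// expr2 -mulrA ler_wpM2l//.
by have /andP[] := sqrt_majorant_itv n.
Qed.

(** The splitting of Z_{n+1}^2 - Z_n^2 as Z_{n+1} (Z_{n+1} - Z_n) + (Z_{n+1} - Z_n) Z_n mirrors a^2
    - b^2 = a (a - b) + (a - b) b, so the operator recursion is dominated term by term by the scalar
    one. *)
Lemma sqrt_iter_step n u :
  `|Z n.+1 u - Z n u| <= (sqrt_majorant n.+1 - sqrt_majorant n) * `|u|.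
Proof.
elim: n u => [|n ih] u.
  rewrite /= addr0 !subr0 normrZ ger0_norm// expr0n addr0 mulr1.
  by rewrite ler_pM2l.
rewrite [X in X - _]sqrt_iterS [X in _ - X]sqrt_iterS.
rewrite -scalerBr opprD addrACA subrr add0r normrZ ger0_norm//.
set a := sqrt_majorant n.+1; set b := sqrt_majorant n.
rewrite (_ : Z _ (Z _ _) - _ = Z n.+1 (Z n.+1 u - Z n u)
  + (Z n.+1 (Z n u) - Z n (Z n u))); last first.
  by rewrite sqrt_iterB addrA subrK.
apply: (@le_trans _ _ (2^-1 * (a * ((a - b) * `|u|) + (a - b) * (b * `|u|)))).
  rewrite ler_pM2l// (le_trans (ler_normD _ _))// lerD//.
    rewrite (le_trans (sqrt_iter_le _ _))// ler_wpM2l//.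
    by have /andP[] := sqrt_majorant_itv n.+1.
  rewrite (le_trans (ih _))// ler_wpM2l ?subr_ge0 ?sqrt_majorant_le//.
  exact: sqrt_iter_le.
have -> : sqrt_majorant n.+2 = 2^-1 * (1 + a ^+ 2) by [].
have aE : a = 2^-1 * (1 + b ^+ 2) by [].
rewrite [X in _ <= (_ - X) * _]aE le_eqVlt; apply/orP; left; apply/eqP.
by clearbody a b; clear; ring.
Qed.

(** The increments are dominated by those of [sqrt_majorant], whose sum telescopes and stays below
    1; completeness then gives the limit. *)
Lemma sqrt_iter_cvg u : cvgn (Z ^~ u).
Proof.
have -> : Z ^~ u = series (telescope (Z ^~ u)).
  by apply/funext => n; rewrite telescopeK/= subr0.
apply: normed_cvg; apply: nondecreasing_is_cvgn.
  by apply: nondecreasing_series => *; rewrite /= ?normr_ge0.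
exists `|u| => _ [n _ <-].
rewrite /series/= (le_trans (y := \sum_(0 <= k < n)
    (sqrt_majorant k.+1 - sqrt_majorant k) * `|u|))//.
  by apply: ler_sum => k _; exact: sqrt_iter_step.
rewrite -mulr_suml telescope_sumr//= subr0.
by have /andP[_ h] := sqrt_majorant_itv n; rewrite -[leRHS]mul1r ler_wpM2r.
Qed.

Lemma sqrt_iter_lim : exists L : bop Y Y,
  [/\ forall u v, inner (L u) v = inner u (L v),
      forall u, `|L u| <= `|u| & forall u, L u = 2^-1 *: (N u + L (L u))].
Proof.
pose L u := limn (Z ^~ u).
have ZL u : Z ^~ u @ \oo --> L u by exact: sqrt_iter_cvg.
have Z1 n u : `|Z n u| <= `|u|.
  rewrite (le_trans (sqrt_iter_le _ _))// -[leRHS]mul1r ler_wpM2r//.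
  by have /andP[] := sqrt_majorant_itv n.
have L1 u : `|L u| <= `|u|.
  by apply: (cvgr_to_le (cvg_norm (ZL u))); apply: nearW => n; exact: Z1.
have Llin : linear L.
  move=> a u v; apply: (norm_cvg_unique (ZL (a *: u + v))) => //.
  rewrite (_ : Z ^~ _ = fun n => a *: Z n u + Z n v); last first.
    by apply/funext => n; rewrite sqrt_iter_linear.
  by apply: cvgD => //; exact: cvgZl_tmp.
have [L' LE] : exists L' : bop Y Y, L = L'.
  by apply: (@bounded_linearP _ _ _ _ 1) => // u; rewrite mul1r.
exists L'; rewrite -LE; split => // u.
  move=> v.
  have innerZL w w' : (fun n => inner (Z n w) w') @ \oo --> inner (L w) w'.
    exact: (@cvg_comp _ _ _ (Z ^~ w) (fun x => inner x w') _ _ _ (ZL w)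
      (@inner_continuous _ _ w' (L w))).
  apply: (@norm_cvg_unique R R^o _ _ _ _ (innerZL u v)).
  rewrite [inner u _]innerC; apply: cvg_trans (innerZL v u).
  by apply: near_eq_cvg; apply: nearW => n /=; rewrite sqrt_iter_sym innerC.
apply: (norm_cvg_unique (ZL u)) => //.
have /= := cvg_shiftS (Z ^~ u) (nbhs (2^-1 *: (N u + L (L u)))) => <-.
apply: cvgZl_tmp; apply: cvgD; first exact: cvg_cst.
(* In [Z n (Z n u)] both factors move. The inner one is replaced by its limit [L u]; the error is at
   most [|Z n u - L u|] because every [Z n] is a contraction. *)
apply: (@cvg_sub0 _ _ _ _ _ _ (fun n => Z n (L u))) => //.
apply: norm_cvg0; apply: (@squeeze_cvgr _ _ _ R (cst 0)
    (fun n => `|Z n u - L u|) _ _ 0).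
- by apply: nearW => n /=; rewrite normr_ge0/= !fctE -sqrt_iterB Z1.
- exact: cvg_cst.
- by apply/norm_cvg0P/subr_cvg0; exact: ZL.
Qed.

End square_root.

Lemma sqrt_op_exists {R : realType} {Y : hilbertType R} (T : bop Y Y) :
  (forall u v, inner (T u) v = inner u (T v)) ->
  (forall u, 0 <= inner (T u) u) ->
  is_sqrt_op T (sqrt_op T).
Proof.
(* The scaling makes N = 1 - T / k satisfy 0 <= N <= 1; if L solves L = (N + L^2) / 2, then (1 -
   L)^2 = T / k, so sqrt k (1 - L) is a root of T. *)
move=> Tsym T0; pose k := `|T| + 1.
have k0 : 0 < k by rewrite ltr_pwDr.
pose N u := u - k^-1 *: T u.
have Nlin : linear N.
  move=> a u v; rewrite /N bopDr bopZr scalerDr opprD addrACA; congr (_ + _).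
  by rewrite scalerBr !scalerA (mulrC a).
have NZ a u : N (a *: u) = a *: N u.
  by rewrite /N bopZr scalerBr !scalerA (mulrC a).
have ND u v : N (u + v) = N u + N v by have := Nlin 1 u v; rewrite !scale1r.
have Nsym u v : inner (N u) v = inner u (N v).
  by rewrite innerBl innerBr innerZl innerZr Tsym.
have NE u : inner (N u) u = `|u| ^+ 2 - k^-1 * inner (T u) u.
  by rewrite innerBl innerZl norm_inner.
have Nge0 u : 0 <= inner (N u) u.
  rewrite NE subr_ge0 ler_pdivrMl// (le_trans (ler_norm _))//.
  rewrite (le_trans (cauchy_schwarz _ _))// expr2 mulrA ler_wpM2r//.
  by rewrite (le_trans (bop_norm_le _ _))// ler_wpM2r// lerDl.
have Nle1 u : inner (N u) u <= `|u| ^+ 2.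
  by rewrite NE lerBlDr lerDl mulr_ge0// invr_ge0 ltW.
(* Cauchy-Schwarz for the form <N u, v> at u and N u gives |N u|^4 <= <N u, u> <N (N u), N u> <=
   |u|^2 |N u|^2. *)
have Nle u : `|N u| <= `|u|.
  have [->|Nu0] := eqVneq (N u) 0; first by rewrite normr0.
  have := @cauchy_schwarz_form _ _ (fun u v => inner (N u) v) _ _ _ Nge0 u (N u).
  rewrite -norm_inner => /(_ _)/= h.
  have {}h : (`|N u| ^+ 2) ^+ 2 <= inner (N u) u * inner (N (N u)) (N u).
    apply: h => [u' v'|u' v' w|a u' w]; first by rewrite Nsym innerC.
      by rewrite ND innerDl.
    by rewrite NZ innerZl.
  have {}h : (`|N u| ^+ 2) ^+ 2 <= `|u| ^+ 2 * `|N u| ^+ 2.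
    by rewrite (le_trans h)// ler_pM.
  have nNu : 0 < `|N u| ^+ 2 by rewrite exprn_gt0// normr_gt0.
  by move: h; rewrite expr2 ler_pM2r// ler_sqr ?nnegrE.
have [L [Lsym L1 LE]] := sqrt_iter_lim N Nlin Nsym Nle.
have Slin : linear (fun u => Num.sqrt k *: (u - L u)).
  move=> a u v; rewrite bopDr bopZr opprD addrACA scalerDr -scalerBr !scalerA.
  by rewrite mulrC.
have [S SE] : exists S : bop Y Y, (fun u => Num.sqrt k *: (u - L u)) = S.
  apply: (@bounded_linearP _ _ _ _ (Num.sqrt k * 2)) => // u.
  rewrite normrZ ger0_norm ?sqrtr_ge0// -mulrA ler_wpM2l ?sqrtr_ge0//.
  by rewrite (le_trans (ler_normB _ _))// mulrDl mul1r lerD.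
suff : is_sqrt_op T S by exact: getI.
split=> [u v|u|u]; rewrite -SE.
- by rewrite innerZl innerZr innerBl innerBr Lsym.
- rewrite innerZl mulr_ge0 ?sqrtr_ge0// innerBl subr_ge0.
  rewrite (le_trans (ler_norm _))// (le_trans (cauchy_schwarz _ _))//.
  by rewrite -norm_inner expr2 ler_wpM2r.
- rewrite bopZr -scalerBr scalerA -expr2 sqr_sqrtr ?ltW//.
  have LLu : L u + L u = N u + L (L u).
    by rewrite {1 2}LE -scalerDl -div1r -splitr scale1r.
  rewrite bopBr opprB.
  have -> : L (L u) - L u = L u - N u.
    by apply/eqP; rewrite subr_eq addrAC LLu addrAC subrr add0r.
  rewrite addrA subrK /N opprB addrC subrK.
  by rewrite scalerA mulfV ?gt_eqF// scale1r.
Qed.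

(** * The space l2 *)

Lemma sum_bool_count (T : Type) (a : pred T) (s : seq T) :
  (\sum_(i <- s) nat_of_bool (a i) = count a s)%N.
Proof. by rewrite -sum1_count [RHS]big_mkcond; apply: eq_bigr => i _; case: (a i). Qed.

Section l2_space.
Context {R : realType}.
Implicit Types u v : l2 R.

Lemma l2D u v i : (u + v) i = u i + v i. Proof. by []. Qed.

Lemma l2Z a u i : (a *: u) i = a * u i. Proof. by []. Qed.

Lemma l2B u v i : (u - v) i = u i - v i. Proof. by []. Qed.

Lemma l2_0 i : (0 : l2 R) i = 0. Proof. by []. Qed.

Lemma l2eE k i : l2e R k i = (i == k)%:R. Proof. by []. Qed.

Lemma l2_sqr_norm u : (`|u| ^+ 2)%:E = (\sum_(0 <= i <oo) (u i ^+ 2)%:E)%E.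
Proof.
have u2 : (('N[@counting nat R]_2%:E[EFin \o u]) < +oo)%E.
  exact: Lfunction_finite.
have u20 : (0 <= 'N[@counting nat R]_2%:E[EFin \o u])%E by exact: Lnorm_ge0.
have -> : (`|u| ^+ 2)%:E = ('N[@counting nat R]_2%:E[EFin \o u] `^ 2)%E.
  rewrite -[ `|u| ]/(l2norm u) /l2norm.
  move: u2 u20; case: ('N[_]_2%:E[_])%E => // r _ r0.
  by rewrite /= powR_mulrn.
rewrite Lnorm_counting// -poweRrM mulVf// poweRe1; last first.
  by apply: nneseries_ge0 => *; exact: poweR_ge0.
apply: eq_eseriesr => i _ /=; congr EFin.
by rewrite powR_mulrn// real_normK// num_real.
Qed.

Lemma l1norm_ge0 u : (0 <= l1norm u)%E.
Proof. by apply: nneseries_ge0 => *; rewrite lee_fin. Qed.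

Lemma l2_coord_le u i : `|u i| <= `|u|.
Proof.
rewrite -ler_sqr ?nnegrE// -lee_fin l2_sqr_norm.
rewrite (nneseriesD1 (n := i))//; last by move=> *; rewrite lee_fin sqr_ge0.
rewrite real_normK ?num_real// leeDl//.
by apply: nneseries_ge0 => *; rewrite lee_fin sqr_ge0.
Qed.

Lemma l1norm_ge_sum u N : ((\sum_(i < N) `|u i|)%:E <= l1norm u)%E.
Proof.
rewrite -sumEFin -(big_mkord xpredT (fun i => `|u i|%:E)).
by apply: nneseries_lim_ge => *; rewrite lee_fin.
Qed.

Lemma l2_norm_le_l1norm u : (`|u|%:E <= l1norm u)%E.
Proof.
have [|l1y] := ltP (l1norm u) +oo%E; last exact: le_trans (leey _) l1y.
have l10 := l1norm_ge0 u.
move=> l1y; have l1fin : l1norm u \is a fin_num by rewrite ge0_fin_numE.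
rewrite -[l1norm u]fineK//.
have fl10 : 0 <= fine (l1norm u) by exact: fine_ge0.
rewrite lee_fin -ler_sqr ?nnegrE// -lee_fin l2_sqr_norm.
apply: lime_le => [|].
  by apply: is_cvg_nneseries => *; rewrite lee_fin sqr_ge0.
apply: nearW => n; rewrite sumEFin big_mkord lee_fin.
apply: (@le_trans _ _ ((\sum_(i < n) `|u i|) ^+ 2)).
  rewrite expr2 mulr_suml; apply: ler_sum => i _.
  rewrite -real_normK ?num_real// expr2 ler_wpM2l// (bigD1 i)//= lerDl.
  exact: sumr_ge0.
rewrite ler_sqr ?nnegrE ?sumr_ge0//.
by rewrite -lee_fin fineK// l1norm_ge_sum.
Qed.

Lemma l2_sqr_norm_finite u N : (forall i, (N <= i)%N -> u i = 0) ->
  `|u| ^+ 2 = \sum_(i < N) u i ^+ 2.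
Proof.
move=> uN; apply: EFin_inj; rewrite l2_sqr_norm.
rewrite (nneseries_split 0 N)//; last by move=> *; rewrite lee_fin sqr_ge0.
rewrite add0n eseries0; last by move=> i Ni _; rewrite uN// expr0n.
by rewrite adde0 sumEFin big_mkord.
Qed.

Lemma l1norm_finite u N : (forall i, (N <= i)%N -> u i = 0) ->
  l1norm u = (\sum_(i < N) `|u i|)%:E.
Proof.
move=> uN; rewrite /l1norm (nneseries_split 0 N)//.
rewrite add0n eseries0; last by move=> i Ni _; rewrite uN// normr0.
by rewrite adde0 sumEFin big_mkord.
Qed.

Definition l2_trunc N u : l2 R := \sum_(i < N) u i *: l2e R i.

Lemma l2_sum (I : Type) (r : seq I) (P : pred I) (f : I -> l2 R) j :
  (\sum_(i <- r | P i) f i) j = \sum_(i <- r | P i) f i j.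
Proof. exact: (big_morph (fun u : l2 R => u j) (fun u v => l2D u v j) (l2_0 j)). Qed.

Lemma l2_truncE N u j : l2_trunc N u j = if (j < N)%N then u j else 0.
Proof.
rewrite l2_sum; under eq_bigr do rewrite l2Z l2eE.
case: ifPn => jN.
  rewrite (bigD1 (Ordinal jN))//= eqxx mulr1 big1 ?addr0// => i.
  by rewrite -val_eqE/= eq_sym => /negbTE ->; rewrite mulr0.
rewrite big1// => i _; case: eqP => [ji|]; rewrite ?mulr0//.
by move: jN; rewrite ji ltn_ord.
Qed.

Lemma l2_trunc_id N u : (forall i, (N <= i)%N -> u i = 0) -> l2_trunc N u = u.
Proof.
move=> uN; apply/LfuneqP => j; rewrite l2_truncE.
by case: ltnP => // /uN.
Qed.

Lemma l1norm_split N u :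
  l1norm u = (l1norm (l2_trunc N u) + l1norm (u - l2_trunc N u)%R)%E.
Proof.
rewrite /l1norm -nneseriesD//; apply: eq_eseriesr => i _.
rewrite l2B l2_truncE -EFinD; case: ifPn => _; first by rewrite subrr normr0 addr0.
by rewrite subr0 normr0 add0r.
Qed.

Lemma l1norm_tail_cvg u : (l1norm u < +oo)%E ->
  l1norm (u - l2_trunc n u) @[n --> \oo] --> 0%E.
Proof.
move=> uy; rewrite (_ : (fun n => _) = (fun N => \sum_(N <= k <oo) `|u k|%:E)%E).
  by apply: nneseries_tail_cvg => // k _; rewrite lee_fin.
apply/funext => N; rewrite /l1norm (nneseries_split 0 N)//.
rewrite big1_seq ?add0e ?add0n; last first.
  move=> i /[!mem_index_iota] /andP[_ /andP[_ iN]].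
  by rewrite l2B l2_truncE iN subrr normr0.
rewrite eseries_cond [RHS]eseries_cond; apply: eq_eseriesr => i /andP[_ Ni].
by rewrite l2B l2_truncE ltnNge Ni subr0.
Qed.

Lemma l2_norm_sum_basis (s : seq nat) : uniq s ->
  `|\sum_(i <- s) l2e R i| ^+ 2 <= (size s)%:R.
Proof.
move=> us; have sE j : (\sum_(i <- s) l2e R i) j = (j \in s)%:R.
  rewrite l2_sum; under eq_bigr do rewrite l2eE eq_sym.
  rewrite -natr_sum; congr _%:R.
  by rewrite sum_bool_count -count_uniq_mem.
pose N := (\max_(i <- s) i).+1.
rewrite (@l2_sqr_norm_finite _ N) => [|j Nj]; last first.
  rewrite sE; case: (boolP (j \in s)) => // js; move: Nj.
  by rewrite ltnNge leq_bigmax_seq.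
under eq_bigr do rewrite sE -natrX.
rewrite -natr_sum ler_nat -(big_mkord xpredT (fun j => (j \in s) ^ 2)%N).
rewrite (eq_bigr (fun j => nat_of_bool (j \in s))); last by move=> j _; case: (_ \in _).
rewrite sum_bool_count -size_filter uniq_leq_size ?filter_uniq ?iota_uniq// => j.
by rewrite mem_filter => /andP[].
Qed.

(** On truncations this is the triangle inequality; truncations of an l1 sequence converge in l1,
    hence in l2. If the l1 norm is infinite, positivity of [c] makes the right-hand side
    infinite. *)
Lemma bop_l2_tail (V : normedModType R) (f : bop (l2 R) V) N (c : R) u :
  (forall i, (N <= i)%N -> `|f (l2e R i)| <= c) -> 0 < c ->
  (forall i, (i < N)%N -> u i = 0) ->
  (`|f u|%:E <= c%:E * l1norm u)%E.
Proof.
move=> fc c0 uN.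
have [uy|l1y] := ltP (l1norm u) +oo%E; last first.
  by move: l1y; rewrite leye_eq => /eqP ->; rewrite gt0_muley ?lte_fin// leey.
have trunc_le n : (`|f (l2_trunc n u)|%:E <= c%:E * l1norm u)%E.
  apply: (@le_trans _ _ (c * \sum_(i < n) `|u i|)%:E); last first.
    rewrite EFinM; apply: lee_wpmul2l; first by rewrite lee_fin ltW.
    exact: l1norm_ge_sum.
  rewrite lee_fin /l2_trunc bop_sum (le_trans (ler_norm_sum _ _ _))//.
  rewrite mulr_sumr ler_sum// => i _; rewrite bopZr normrZ mulrC.
  have [iN|Ni] := ltnP i N; first by rewrite uN// normr0 !mulr0.
  by rewrite ler_wpM2r// fc.
have fin1 n : l1norm (u - l2_trunc n u)%R \is a fin_num.
  rewrite ge0_fin_numE ?l1norm_ge0// (le_lt_trans _ uy)//.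
  by rewrite (l1norm_split n u) leeDr// l1norm_ge0.
have le_n n : (`|f u|%:E <=
    c%:E * l1norm u + `|f|%:E * l1norm (u - l2_trunc n u)%R)%E.
  have := bop_norm_le f (u - l2_trunc n u); rewrite bopBr => h.
  have {h} : `|f u| <= `|f (l2_trunc n u)| + `|f| * `|u - l2_trunc n u|.
    rewrite -lerBlDl (le_trans _ h)//.
    by rewrite -[leRHS]normr_id (le_trans (lerB_dist _ _))// normr_id.
  rewrite -lee_fin EFinD EFinM => /le_trans; apply.
  apply: leeD => //; apply: lee_wpmul2l; first by rewrite lee_fin.
  exact: l2_norm_le_l1norm.
have cv : (c%:E * l1norm u + `|f|%:E * l1norm (u - l2_trunc n u)%R)%E
    @[n --> \oo] --> (c%:E * l1norm u)%E.
  rewrite -[X in _ --> X]adde0 -[X in _ --> (_ + X)%E](mule0 `|f|%:E).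
  apply: cvgeD; first by rewrite mule0 fin_num_adde_defl.
    exact: cvg_cst.
  by apply: cvgeZl => //; exact: l1norm_tail_cvg.
by apply: (cvge_to_ge cv); apply: nearW => n; exact: le_n.
Qed.

End l2_space.

(** * Compactness *)

Lemma uniform_threshold (T : eqType) (s : seq T) (P : T -> nat -> Prop) :
  (forall c, c \in s -> exists N, forall i, (N <= i)%N -> P c i) ->
  exists N, forall c i, c \in s -> (N <= i)%N -> P c i.
Proof.
elim: s => [|c s ih] H; first by exists 0.
have [N1 N1P] := H c (mem_head _ _).
have [|N2 N2P] := ih; first by move=> c' c's; apply: H; rewrite inE c's orbT.
exists (maxn N1 N2) => c' i; rewrite inE geq_max => /predU1P[->|c's] /andP[? ?].
  exact: N1P.
exact: N2P.
Qed.

Lemma uniform_gt0 (R : realType) (T : eqType) (s : seq T) (f : T -> R) :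
  (forall c, c \in s -> 0 < f c) ->
  exists2 m, 0 < m & forall c, c \in s -> m <= f c.
Proof.
elim: s => [|c s ih] H; first by exists 1.
have fc0 := H c (mem_head _ _).
have [|m m0 mf] := ih; first by move=> c' c's; apply: H; rewrite inE c's orbT.
exists (Num.min (f c) m); first by rewrite lt_min fc0.
move=> c'; rewrite inE => /predU1P[->|c's]; first by rewrite ge_min lexx.
by rewrite ge_min mf ?orbT.
Qed.

Section compact_sets.
Context {R : realType} {V : normedModType R}.

(** The radius may depend on the centre: uniform coercivity needs balls whose size follows the local
    coercivity constant. *)
Lemma compact_finite_net (C : set V) (r : V -> R) : compact C ->
  (forall c, C c -> 0 < r c) ->
  exists s : seq V, (forall c, c \in s -> C c) /\
    forall x, C x -> exists2 c, c \in s & `|c - x| < r c.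
Proof.
move=> + r0; rewrite compact_cover => /(_ V C (fun c => ball c (r c))).
case=> [c Cc||s sC Cs]; first exact: ball_open.
- by move=> x Cx; exists x => //; apply: ballxx; exact: r0.
- exists s; split=> [c cs|x Cx]; first by move/sC: cs; rewrite inE.
  have [c /= cs] := Cs x Cx; rewrite -ball_normE => cx.
  by exists c.
Qed.

Lemma compact_norm_bounded (C : set V) : compact C ->
  exists2 b, 0 < b & forall x, C x -> `|x| <= b.
Proof.
move=> /compact_bounded[M [Mreal HM]].
exists (`|M| + 1); first by rewrite ltr_wpDl.
by move=> x Cx; apply: HM => //; rewrite (le_lt_trans (ler_norm _))// ltrDl.
Qed.

End compact_sets.

Lemma precompact_image_bounded {R : realType} {V W : normedModType R}
    (f : V -> W) : compact_operator f -> exists g : bop V W, f = g.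
Proof.
case=> lf; rewrite precompactE => /compact_norm_bounded[b b0 fb].
apply: (@bounded_linearP _ _ _ _ b) => // x.
have fZ a y : f (a *: y) = a *: f y.
  exact: (scalable_linear lf).
have [->|x0] := eqVneq x 0.
  have -> : f 0 = 0 by rewrite -(scale0r (0 : V)) fZ scale0r.
  by rewrite !normr0 mulr0.
have nx : 0 < `|x| by rewrite normr_gt0.
have /fb : closure (f @` [set x | `|x| <= 1]) (f (`|x|^-1 *: x)).
  apply: subset_closure; exists (`|x|^-1 *: x) => //=.
  by rewrite normrZ normfV normr_id mulVf ?gt_eqF.
by rewrite fZ normrZ normfV normr_id ler_pdivrMl// mulrC.
Qed.

Section compact_on_l2.
Context {R : realType} {Y : normedModType R}.

Lemma l2e_norm_le1 i : `|l2e R i| <= 1.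
Proof.
have := @l2_norm_sum_basis R [:: i] isT; rewrite big_seq1.
by rewrite -[X in _ <= X](expr1n _ 2) ler_sqr ?nnegrE.
Qed.

(* If infinitely many [T e_i] of norm at least [d] were close to a common [c],
   then the sum of [n] of them would have norm of order [n], whereas
   orthonormality bounds it by [|T| * sqrt n]. *)
Lemma totally_bounded_basis_cvg0 (T : bop (l2 R) Y) :
  (forall d : R, 0 < d -> exists s : seq Y,
    forall i, exists2 c, c \in s & `|c - T (l2e R i)| < d) ->
  forall d : R, 0 < d -> exists N, forall i, (N <= i)%N -> `|T (l2e R i)| <= d.
Proof.
move=> tb d d0; have d40 : 0 < d / 4 by rewrite divr_gt0.
have [s sP] := tb _ d40.
pose I c := [set i | d < `|T (l2e R i)| /\ `|c - T (l2e R i)| < d / 4].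
have Ifin c : finite_set (I c).
  apply: contrapT => Iinf.
  (* The estimate below yields n d / 2 <= |T| sqrt n, that is n <= k, for any n indices in [I c];
     more than k of them are selected. *)
  pose k := 4 * `|T| ^+ 2 / d ^+ 2.
  have [B BI] := infinite_set_fset (Num.truncn k).+1 Iinf.
  move=> Bk.
  have kn : k < #|` B|%:R.
    by rewrite (lt_le_trans (truncnS_gt _))// ler_nat.
  have n0 : 0 < #|` B|%:R :> R by rewrite ltr0n (leq_trans _ Bk).
  have c3 : 3 * (d / 4) <= `|c|.
    have [i iB] : exists i, i \in B.
      by apply/fset0Pn; rewrite -cardfs_gt0 (leq_trans _ Bk).
    have [dTi cTi] := BI i iB.
    have := lerB_dist (T (l2e R i)) c; rewrite distrC.
    by move: dTi cTi; clear; lra.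
  (* The left side has norm at least 3 n d / 4 and the first sum at most n d / 4, which leaves n d /
     2 for the image of the sum of basis vectors. *)
  have sumE : #|` B|%:R *: c
      = \sum_(i <- B) (c - T (l2e R i)) + T (\sum_(i <- B) l2e R i).
    rewrite bop_sum -big_split/= (eq_bigr (fun=> c)); last first.
      by move=> i _; rewrite subrK.
    by rewrite big_const_seq count_predT iter_addr_0 scaler_nat cardfE.
  have sum1 : `|\sum_(i <- B) (c - T (l2e R i))| <= #|` B|%:R * (d / 4).
    rewrite (le_trans (ler_norm_sum _ _ _))//.
    rewrite big_seq (le_trans (y := \sum_(i <- B | i \in B) d / 4))//.
      by apply: ler_sum => i iB; have [_ /ltW] := BI i iB.
    by rewrite -big_seq big_const_seq count_predT iter_addr_0 mulr_natl cardfE.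
  have sum2 := bop_norm_le T (\sum_(i <- B) l2e R i).
  have sum3 := @l2_norm_sum_basis R _ (fset_uniq B).
  have := ler_normD (\sum_(i <- B) (c - T (l2e R i))) (T (\sum_(i <- B) l2e R i)).
  rewrite -sumE normrZ normr_nat => sum4.
  set t := `|\sum_(i <- B) l2e R i| in sum2 sum3 *.
  set n : R := #|` B|%:R in kn n0 sumE sum1 sum4 *.
  have {}sum3 : t ^+ 2 <= n by exact: sum3.
  have nd : n * (d / 2) <= `|T| * t.
    have : n * (3 * (d / 4)) <= n * `|c| by rewrite ler_wpM2l// ltW.
    by move: sum1 sum2 sum4; clear; lra.
  have : (n * (d / 2)) ^+ 2 <= `|T| ^+ 2 * n.
    rewrite (@le_trans _ _ ((`|T| * t) ^+ 2))//.
      have [n0' d0'] := (ltW n0, ltW d0).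
    by rewrite ler_sqr ?nnegrE ?mulr_ge0 ?divr_ge0 /t.
    by rewrite exprMn ler_wpM2l// sqr_ge0.
  move: kn; rewrite /k ltr_pdivrMr ?exprn_gt0// => kn.
  by move: (n0) kn; clear; nra.
have : finite_set (\bigcup_(c in [set` s]) I c) by exact: bigcup_finite.
move=> /finite_fsetP[D DE].
exists (\max_(i <- D) i).+1 => i iN; rewrite leNgt; apply/negP => di.
have [c cs ci] := sP i.
have : (\bigcup_(c in [set` s]) I c) i by exists c.
rewrite DE/= => iD.
have := @leq_bigmax_seq _ (enum_fset D) xpredT id i iD isT.
by rewrite leqNgt iN.
Qed.

End compact_on_l2.

Section finite_dimensional.
Context {R : realType}.

(** Parametrizes the first [N] coordinates by row vectors, for which boxes are compact and the
    extreme value theorem applies. *)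
Definition l2_of_rV N (v : 'rV[R]_N) : l2 R := \sum_(i < N) v ord0 i *: l2e R i.

Lemma l2_of_rVE N (v : 'rV[R]_N) (i : 'I_N) : l2_of_rV N v i = v ord0 i.
Proof.
rewrite l2_sum; under eq_bigr do rewrite l2Z l2eE.
rewrite (bigD1 i)//= eqxx mulr1 big1 ?addr0// => j.
by rewrite -val_eqE/= eq_sym => /negbTE ->; rewrite mulr0.
Qed.

Lemma l2_of_rV0 N (v : 'rV[R]_N) j : (N <= j)%N -> l2_of_rV N v j = 0.
Proof.
move=> Nj; rewrite l2_sum big1// => i _; rewrite l2Z l2eE gtn_eqF ?mulr0//.
by rewrite (leq_trans (ltn_ord i)).
Qed.

Lemma l2_of_rV_continuous N : continuous (l2_of_rV N).
Proof.
apply: continuous_big => [|i _ v]; first exact: add_continuous.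
by apply: (cvgZr_tmp (F := nbhs v)); exact: (@coord_continuous R 1 N ord0 i v).
Qed.

Lemma bop_l2_of_rV_continuous (Y : normedModType R) (T : bop (l2 R) Y) N :
  continuous (fun v => T (l2_of_rV N v)).
Proof.
move=> v; exact: (continuous_comp (l2_of_rV_continuous N v)
  (@bop_continuous _ _ _ T (l2_of_rV N v))).
Qed.

Lemma l2_of_rV_trunc N (u : l2 R) : (forall i, (N <= i)%N -> u i = 0) ->
  l2_of_rV N (\row_i u i) = u.
Proof.
move=> uN; rewrite -[RHS](l2_trunc_id N)//.
by apply: eq_bigr => i _; rewrite mxE.
Qed.

Lemma sum_norm_rV_continuous N :
  continuous (fun v : 'rV[R]_N => \sum_(i < N) `|v ord0 i|).
Proof.
apply: continuous_big => [|i _ v]; first exact: add_continuous.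
by apply: (cvg_norm (F := nbhs v)); exact: (@coord_continuous R 1 N ord0 i v).
Qed.

Lemma rV_box_compact N (M : R) :
  compact [set v : 'rV[R]_N | forall i, `[- M, M]%classic (v ord0 i)].
Proof.
by apply: (@rV_compact R N (fun=> `[- M, M]%classic)) => i; exact: segment_compact.
Qed.

Lemma l2_norm_finite_le N (u : l2 R) : (forall i, (N <= i)%N -> u i = 0) ->
  `|u| <= \sum_(i < N) `|u i|.
Proof.
by move=> uN; rewrite -lee_fin -l1norm_finite// l2_norm_le_l1norm.
Qed.

(** The constant is the minimum of |T u| on the unit sphere of the l1 norm, positive by injectivity;
    homogeneity and |u| <= |u|_1 give the estimate. *)
Lemma finite_dimensional_coercive (Y : normedModType R) (T : bop (l2 R) Y) N :
  (forall u : l2 R, (forall i, (N <= i)%N -> u i = 0) -> T u = 0 -> u = 0) ->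
  exists2 c : R, 0 < c & forall u : l2 R, (forall i, (N <= i)%N -> u i = 0) ->
    c * `|u| <= `|T u|.
Proof.
move=> Tinj.
pose n1 (v : 'rV[R]_N) := \sum_(i < N) `|v ord0 i|.
pose K := [set v : 'rV[R]_N | forall i, `[- 1, 1]%classic (v ord0 i)]
  `&` n1 @^-1` [set 1].
have Kcpt : compact K.
  apply: compact_closedI; first exact: rV_box_compact.
  apply: preimage_closed; last exact: closed_eq.
  by move=> v _; exact: sum_norm_rV_continuous.
have n1K v : n1 v = 1 -> K v.
  move=> v1; split=> //= i; rewrite in_itv/= -ler_norml -v1 /n1.
  by rewrite (bigD1 i)//= lerDl sumr_ge0.
have n1E (u : l2 R) : (forall i, (N <= i)%N -> u i = 0) ->
    n1 (\row_i u i) = \sum_(i < N) `|u i|.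
  by move=> uN; apply: eq_bigr => i _; rewrite mxE.
(* The sphere is empty when [N] is 0; the extreme value theorem needs a nonempty set. *)
have [K0|K0] := eqVneq K set0.
  exists 1 => // u uN; suff -> : u = 0 by rewrite !normr0 mulr0 normr_ge0.
  apply/eqP; rewrite -normr_le0 (le_trans (l2_norm_finite_le N u uN))//.
  rewrite -n1E// leNgt; apply/negP => n0.
  have : K ((n1 (\row_i u i))^-1 *: \row_i u i).
    apply: n1K; rewrite /n1.
    under eq_bigr do rewrite mxE normrM.
    rewrite -mulr_sumr -[X in _ * X]/(n1 _) ger0_norm ?invr_ge0 ?ltW//.
    by rewrite mulVf// gt_eqF.
  by rewrite K0.
have [v0 /[!inE] [[_ /= v01]] v0min] : exists2 c : 'rV[R]_N, c \in K &
    forall t, t \in K -> `|T (l2_of_rV N c)| <= `|T (l2_of_rV N t)|.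
  apply: EVT_min_rV => //; first exact/set0P.
  apply: continuous_subspaceT => v; apply: (cvg_norm (F := nbhs v)).
  exact: bop_l2_of_rV_continuous.
set m := `|T _| in v0min.
have m0 : 0 < m.
  rewrite normr_gt0; apply/eqP => /Tinj => v00.
  have {}v00 : l2_of_rV N v0 = 0 by apply: v00 => i; exact: l2_of_rV0.
  move: v01; rewrite /n1 big1 => [/eqP|i _]; first by rewrite eq_sym oner_eq0.
  by rewrite -l2_of_rVE v00 l2_0 normr0.
exists m => // u uN.
have [u0|u0] := eqVneq (\sum_(i < N) `|u i|) 0.
  have -> : u = 0.
    by apply/eqP; rewrite -normr_le0 (le_trans (l2_norm_finite_le N u uN))// u0.
  by rewrite normr0 mulr0 normr_ge0.
set a := \sum_(i < N) _ in u0.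
have a0 : 0 < a by rewrite lt_neqAle eq_sym u0 sumr_ge0.
have Ku : K (\row_i (a^-1 *: u) i).
  apply: n1K; rewrite n1E => [|i Ni]; last by rewrite l2Z uN// mulr0.
  under eq_bigr do rewrite l2Z normrM.
  by rewrite -mulr_sumr ger0_norm ?invr_ge0 ?ltW// mulVf.
have := v0min _ (mem_set Ku).
rewrite l2_of_rV_trunc => [|i Ni]; last by rewrite l2Z uN// mulr0.
have a0' := ltW a0.
rewrite bopZr normrZ ger0_norm ?invr_ge0// ler_pdivlMl// => h.
rewrite (le_trans _ h)// mulrC; apply: ler_wpM2r; first exact: ltW.
by rewrite /a l2_norm_finite_le.
Qed.

End finite_dimensional.

(** * The variational problem *)

Section reconstruction_stability.
Context {R : realType} {X Y : hilbertType R}.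
Variables (A W : bop X Y) (Sigma : bop Y Y) (Bset : set (bop (l2 R) X)).
Local Notation S := (sqrt_op Sigma).
Hypothesis Sigma_inj : injective Sigma.
Hypothesis S_sqrt : is_sqrt_op Sigma S.
Hypothesis SigmaW : forall x, Sigma (W x) = A x.
Hypothesis W_compact : precompact (W @` [set x | `|x| <= 1]).
Hypothesis Bset_compact : compact Bset.

Let SS u : S (S u) = Sigma u. Proof. by case: S_sqrt. Qed.

Let S_inj : injective S.
Proof. by move=> u v uv; apply: Sigma_inj; rewrite -!SS uv. Qed.

(** The cross term is written with [Sigma], not [S]: for h = W x it becomes <A x, k>, which is
    bounded by a multiple of |k| rather than |S k|. *)
Lemma sqr_norm_sqrtD h k :
  `|S (h + k)| ^+ 2 = `|S h| ^+ 2 + 2 * inner (Sigma h) k + `|S k| ^+ 2.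
Proof.
have [S_sym _ _] := S_sqrt.
rewrite bopDr !norm_inner innerDl !innerDr -SS (S_sym (S h) k).
rewrite [inner (S k) (S h)]innerC; ring.
Qed.

(** [W] stands for Sigma^-1 A, so [S \o W] is Sigma^(-1/2) A; injectivity of [S] and [Sigma]
    identifies the preimages that [op_inv] selects. *)
Lemma objectiveE B y u : objective A Sigma B y u =
  ((2^-1 * `|S (W (B u))| ^+ 2 - inner y (W (B u)))%:E + l1norm u)%E.
Proof.
rewrite /objective; congr ((2^-1 * `|_| ^+ 2 - inner y _)%:E + _)%E.
- apply: S_inj; rewrite SS SigmaW.
  by apply: (@getI _ [set x | S x = A (B u)] (S (W (B u)))); rewrite /= SS.
- apply: Sigma_inj; rewrite SigmaW.
  exact: (@getI _ [set x | Sigma x = A (B u)] (W (B u))).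
Qed.

(** An Ehrling-type inequality. Points of the closed image of the unit ball with norm at least [d]
    form a compact set, on which |S z| has a positive minimum since [S] is injective; the other
    points fall under the term [d * |h|]. *)
Lemma W_S_interpolation (d : R) : 0 < d -> exists2 c, 0 < c &
  forall h, `|W h| <= d * `|h| + c * `|S (W h)|.
Proof.
move=> d0; pose K := closure (W @` [set x | `|x| <= 1]) `&` [set z | d <= `|z|].
have Kcpt : compact K.
  apply: compact_closedI; first by move: W_compact; rewrite precompactE.
  apply: (@preimage_closed _ _ _ [set r | d <= r]); last exact: closed_ge.
  by move=> v _; exact: norm_continuous.
have KW h : `|h| <= 1 -> d <= `|W h| -> K (W h).
  by move=> h1 dh; split => //; apply: subset_closure; exists h.
suff [c c0 Hc] : exists2 c, 0 < c & forall h, `|h| <= 1 ->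
    `|W h| <= d \/ `|W h| <= c * `|S (W h)|.
  exists c => // h; have [->|h0] := eqVneq h 0.
    by rewrite linear0 normr0 addr_ge0// mulr_ge0// ltW.
  have nh : 0 < `|h| by rewrite normr_gt0.
  have := Hc (`|h|^-1 *: h); rewrite !bopZr !normrZ normfV normr_id.
  rewrite mulVf ?gt_eqF// => /(_ (lexx _)).
  rewrite [c * (_ * _)]mulrCA ler_pM2l ?invr_gt0// ler_pdivrMl// mulrC.
  have := normr_ge0 (S (W h)); have := ltW c0; have := ltW d0.
  by move: nh c0 d0; nra.
have [K0|/set0P K0] := eqVneq K set0.
  exists 1 => // h h1; left; rewrite leNgt; apply/negP => /ltW dh.
  by have := KW h h1 dh; rewrite K0.
have [z0 /[!inE] [[_ /= dz0] z0min]] : exists2 z, z \in K &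
    forall t, t \in K -> `|S z| <= `|S t|.
  apply: compact_EVT_min => //; apply: continuous_subspaceT => v.
  by apply: (cvg_norm (F := nbhs v)); exact: bop_continuous.
have m0 : 0 < `|S z0|.
  rewrite normr_gt0; apply: contraTneq dz0 => Sz0; rewrite -ltNge.
  suff -> : z0 = 0 by rewrite normr0.
  by apply: S_inj; rewrite Sz0 linear0.
exists ((`|W| + 1) / `|S z0|); first by rewrite divr_gt0// ltr_wpDl.
move=> h h1; have [dh|/ltW dh] := leP `|W h| d; [by left|right].
have := z0min _ (mem_set (KW h h1 dh)) => Sz0.
rewrite (le_trans (bop_norm_le _ _))// (@le_trans _ _ (`|W| + 1))//.
  by rewrite -[leRHS]mulr1 ler_pM// lerDl.
by rewrite -mulrA ler_peMr ?addr_ge0// mulrC ler_pdivlMr// mul1r.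
Qed.

Lemma Bset_bounded : exists2 b, 0 < b & forall B, Bset B -> `|B| <= b.
Proof. exact: compact_norm_bounded. Qed.

Lemma image_basis_totally_bounded (B : bop (l2 R) X) (d : R) : 0 < d ->
  exists s : seq Y, forall i, exists2 c, c \in s & `|c - bop_comp W B (l2e R i)| < d.
Proof.
move=> d0; pose b := `|B| + 1; have b0 : 0 < b by rewrite ltr_wpDl.
have Kcpt : compact (closure (W @` [set x | `|x| <= 1])).
  by move: W_compact; rewrite precompactE.
have [s [_ sP]] := compact_finite_net _ (fun=> d / b) Kcpt
  (fun _ _ => divr_gt0 d0 b0).
exists [seq b *: c | c <- s] => i.
have [|c cs cd] := sP (W (b^-1 *: B (l2e R i))).
  apply: subset_closure; exists (b^-1 *: B (l2e R i)) => //=.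
  rewrite normrZ normfV (gtr0_norm b0) ler_pdivrMl// mulr1.
  rewrite (le_trans (bop_norm_le _ _))// (@le_trans _ _ `|B|) ?lerDl//.
  by rewrite -[leRHS]mulr1 ler_wpM2l// l2e_norm_le1.
exists (b *: c); first by apply/mapP; exists c.
rewrite -[bop_comp W B _]/(W (B (l2e R i))).
have -> : W (B (l2e R i)) = b *: W (b^-1 *: B (l2e R i)).
  by rewrite bopZr scalerA mulfV ?gt_eqF// scale1r.
by rewrite -scalerBr normrZ (gtr0_norm b0) mulrC -ltr_pdivlMr.
Qed.

(** For a single [B] this is [totally_bounded_basis_cvg0]. A finite net of [Bset] makes the index
    uniform: half of [d] pays for the centres, and the radius is such that passing to a centre costs
    the other half. *)
Lemma image_basis_decay (d : R) : 0 < d ->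
  exists N, forall B i, Bset B -> (N <= i)%N -> `|W (B (l2e R i))| <= d.
Proof.
move=> d0; pose r := d / 2 / (`|W| + 1).
have W1 : 0 < `|W| + 1 by rewrite ltr_wpDl.
have d2 : 0 < d / 2 by rewrite divr_gt0.
have r0 : 0 < r by rewrite divr_gt0.
have [s [sB sP]] := compact_finite_net _ (fun=> r) Bset_compact (fun _ _ => r0).
have [|N NP] := @uniform_threshold _ s (fun B i => `|W (B (l2e R i))| <= d / 2).
  move=> B _; apply: (@totally_bounded_basis_cvg0 _ _ (bop_comp W B)) => //.
  exact: image_basis_totally_bounded.
exists N => B i BB Ni; have [B' B's BB'] := sP B BB.
have -> : W (B (l2e R i)) = W (B' (l2e R i)) - W ((B' - B) (l2e R i)).
  by rewrite bopB bopBr opprB addrC subrK.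
rewrite (le_trans (ler_normB _ _))// [leRHS]splitr; apply: lerD; first exact: NP.
rewrite (le_trans (bop_norm_le _ _))//.
have h : `|(B' - B) (l2e R i)| <= r.
  rewrite (le_trans (bop_norm_le _ _))// -[leRHS]mulr1 ler_pM ?l2e_norm_le1//.
  exact: ltW.
rewrite (@le_trans _ _ ((`|W| + 1) * r))//; first by rewrite ler_pM// lerDl.
by rewrite /r mulrC divfK// gt_eqF.
Qed.

Lemma objective_bound (Q : R) : 0 < Q -> exists2 M, 0 < M &
  forall B y u, Bset B -> `|y| <= Q -> (objective A Sigma B y u <= 0)%E ->
    (l1norm u <= M%:E)%E.
Proof.
move=> Q0; have [b b0 bB] := Bset_bounded.
have Qb0 : 0 < Q * b by rewrite mulr_gt0.
(* With this small constant the linear term is at most |u|_1 / 2 + Q c t, where t = |S W B u|. A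
   nonpositive objective then gives |u|_1 / 2 <= Q c t - t^2 / 2 <= (Q c)^2 / 2. *)
have [|c c0 cW] := @W_S_interpolation (2^-1 / (Q * b)); first by rewrite divr_gt0.
exists ((Q * c) ^+ 2); first by rewrite exprn_gt0// mulr_gt0.
move=> B y u BB yQ; rewrite objectiveE.
have := l2_norm_le_l1norm u; have := l1norm_ge0 u.
case: (l1norm u) => [l| |]//; rewrite ?lee_fin => l0 ul Ju.
set t := `|S _| in Ju; have t0 : 0 <= t by exact: normr_ge0.
have yW : inner y (W (B u)) <= 2^-1 * l + Q * c * t.
  rewrite (le_trans (ler_norm _))// (le_trans (cauchy_schwarz _ _))//.
  rewrite (@le_trans _ _ (Q * `|W (B u)|))//; first by rewrite ler_wpM2r.
  rewrite (@le_trans _ _ (Q * (2^-1 / (Q * b) * (b * l) + c * t)))//.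
    rewrite ler_wpM2l ?(ltW Q0)// (le_trans (cW _))// lerD2r.
    rewrite ler_wpM2l ?divr_ge0 ?(ltW Qb0)//.
    by rewrite (le_trans (bop_norm_le _ _))// ler_pM// bB.
  rewrite mulrDr [Q * (c * t)]mulrA lerD//.
  rewrite le_eqVlt; apply/orP; left; apply/eqP; field.
  by rewrite !gt_eqF.
have tQc := sqr_ge0 (t - Q * c).
by nra.
Qed.

(** Let p be the truncation, r the tail and h = W B r. Passing from p to u changes the objective by
    <A B p, h> + |S h|^2 / 2 - <y, h> + |r|_1. The two scalar products are at most k |h| in absolute
    value, and [N] is taken so large that k |h| <= |r|_1 / 2. *)
Lemma objective_truncation (Q : R) : 0 < Q -> exists2 M, 0 < M & exists N,
  forall B y u, Bset B -> `|y| <= Q -> (objective A Sigma B y u <= 0)%E ->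
    (l1norm u <= M%:E)%E /\
    (objective A Sigma B y (l2_trunc N u)
      + 2^-1%:E * l1norm (u - l2_trunc N u)%R <= objective A Sigma B y u)%E.
Proof.
have arith (e f l0 l1 g h0 a b0 c : R) :
    f <= a -> - b0 <= g -> 0 <= h0 -> b0 + a <= 2^-1 * l1 ->
    2^-1 * e - c + l0 + 2^-1 * l1 <= 2^-1 * (e + 2 * g + h0) - (c + f) + (l0 + l1).
  by lra.
move=> Q0; have [b b0 bB] := Bset_bounded.
have [M M0 MP] := objective_bound Q Q0.
exists M => //.
pose k := `|A| * (b * M) + Q.
have k0 : 0 < k by rewrite ltr_wpDl// !mulr_ge0// ltW.
have d0 : 0 < 2^-1 / k by rewrite divr_gt0.
have [N NP] := image_basis_decay _ d0.
exists N => B y u BB yQ Ju; have lM := MP B y u BB yQ Ju; split => //.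
set p := l2_trunc N u; set r := (u - p)%R.
have upr : u = p + r by rewrite addrC subrK.
have lsplit := l1norm_split N u; rewrite -/p -/r in lsplit.
have lp0 := l1norm_ge0 p; have lr0 := l1norm_ge0 r.
have Wr : (`|W (B r)|%:E <= (2^-1 / k)%:E * l1norm r)%E.
  apply: (@bop_l2_tail _ _ (bop_comp W B) N) => // [i Ni|i iN].
    exact: NP.
  by rewrite /r /p l2B l2_truncE iN subrr.
have pu := l2_norm_le_l1norm p.
rewrite !objectiveE.
move: lM lsplit lp0 lr0 Wr pu => /[swap] ->.
case: (l1norm p) => [lp| |]; case: (l1norm r) => [lr| |]//.
rewrite !lee_fin => lM lp0 lr0 Wr pu.
rewrite upr (bopDr B) (bopDr W) sqr_norm_sqrtD innerDr SigmaW.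
set h := W (B r) in Wr *.
have Sh := sqr_ge0 `|S h|.
have yh : inner y h <= Q * `|h|.
  rewrite (le_trans (ler_norm _))// (le_trans (cauchy_schwarz _ _))//.
  by rewrite ler_wpM2r.
have Ah : - (`|A| * (b * M) * `|h|) <= inner (A (B p)) h.
  rewrite lerNl (le_trans (ler_norm _))// normrN.
  rewrite (le_trans (cauchy_schwarz _ _))// ler_wpM2r//.
  rewrite (le_trans (bop_norm_le _ _))// ler_wpM2l//.
  rewrite (le_trans (bop_norm_le _ _))// ler_pM// ?bB//.
  by rewrite (le_trans pu)// (le_trans _ lM)// lerDl.
have kh : k * `|h| <= 2^-1 * lr.
  rewrite (le_trans (ler_wpM2l (ltW k0) Wr))// mulrA mulrCA mulfV ?mulr1//.
  by rewrite gt_eqF.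
move: kh; rewrite /k mulrDl => kh.
exact: arith yh Ah Sh kh.
Qed.

End reconstruction_stability.

(** * Existence and stability of minimizers *)

Section reconstruction_lipschitz.
Context {R : realType} {X Y : hilbertType R}.
Variables (A W : bop X Y) (Sigma : bop Y Y) (Bset : set (bop (l2 R) X)).
Local Notation S := (sqrt_op Sigma).
Hypothesis Sigma_inj : injective Sigma.
Hypothesis S_sqrt : is_sqrt_op Sigma S.
Hypothesis SigmaW : forall x, Sigma (W x) = A x.
Hypothesis W_compact : precompact (W @` [set x | `|x| <= 1]).
Hypothesis Bset_compact : compact Bset.
Hypothesis Bset_fbi : forall B, Bset B -> finite_basis_injective (A \o B).

Lemma l2_span_iota (u : l2 R) N : (forall i, (N <= i)%N -> u i = 0) ->
  l2_span [fset x in iota 0 N]%fset u.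
Proof.
move=> uN; exists (u : nat -> R) => //; rewrite -[RHS](l2_trunc_id N)//.
rewrite /l2_trunc -(big_mkord xpredT (fun i => u i *: l2e R i)).
apply: perm_big; apply: uniq_perm; rewrite ?fset_uniq ?iota_uniq// => i.
by rewrite in_fset /index_iota subn0.
Qed.

(** As A = Sigma W = S (S W), a zero of S W B is a zero of A B, so finite basis injectivity carries
    over. *)
Lemma data_operator_coercive N B : Bset B -> exists2 c, 0 < c &
  forall u : l2 R, (forall i, (N <= i)%N -> u i = 0) ->
    c * `|u| <= `|S (W (B u))|.
Proof.
move=> BB.
apply: (@finite_dimensional_coercive _ _ (bop_comp S (bop_comp W B))) => u uN.
rewrite -[bop_comp _ _ _]/(S (W (B u))) => SWu.
have [_ _ SS] := S_sqrt.
apply: (Bset_fbi B BB [fset x in iota 0 N]%fset).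
- by rewrite inE; exact: l2_span_iota.
- by rewrite inE; apply: l2_span_iota => i _; rewrite l2_0.
- by rewrite /= -!SigmaW -!SS SWu !linear0.
Qed.

(** A local constant survives, halved, in the ball of radius [f B / 2 / k] around [B]; finitely many
    such balls cover [Bset]. *)
Lemma data_operator_uniformly_coercive N : exists2 c, 0 < c &
  forall B (u : l2 R), Bset B -> (forall i, (N <= i)%N -> u i = 0) ->
    c * `|u| <= `|S (W (B u))|.
Proof.
have /choice[f fP] : forall B, exists c, 0 < c /\ (Bset B ->
    forall u : l2 R, (forall i, (N <= i)%N -> u i = 0) ->
    c * `|u| <= `|S (W (B u))|).
  move=> B; have [/data_operator_coercive -/(_ N)[c c0 cP]|nB] := pselect (Bset B).
    by exists c.
  (* Arbitrary value outside [Bset], only to make [f] total. *)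
  by exists 1.
pose k := `|S| * `|W| + 1.
have k0 : 0 < k by rewrite ltr_wpDl// mulr_ge0.
have r0 B : Bset B -> 0 < f B / 2 / k.
  by move=> _; rewrite !divr_gt0//; have [] := fP B.
have [s [sB sP]] := compact_finite_net _ _ Bset_compact r0.
have [|c c0 cf] := @uniform_gt0 _ _ s (fun B => f B / 2).
  by move=> B _; rewrite divr_gt0//; have [] := fP B.
exists c => // B u BB uN; have [B' B's BB'] := sP B BB.
have [f0 /(_ (sB _ B's) u uN)] := fP B'.
have -> : S (W (B' u)) = S (W (B u)) + S (W ((B' - B) u)).
  by rewrite -!bopDr bopB addrC subrK.
move=> /le_trans -/(_ _ (ler_normD _ _)).
have h : `|S (W ((B' - B) u))| <= f B' / 2 * `|u|.
  rewrite (le_trans (bop_norm_le _ _))//.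
  rewrite (@le_trans _ _ (`|S| * (`|W| * (`|B' - B| * `|u|))))//.
    by rewrite !ler_wpM2l// (le_trans (bop_norm_le _ _))// ler_wpM2l// bop_norm_le.
  rewrite !mulrA ler_wpM2r// (@le_trans _ _ (k * `|B' - B|))//.
    by rewrite ler_wpM2r// lerDl.
  by rewrite mulrC -ler_pdivlMr// ltW.
have h2 : c * `|u| <= f B' / 2 * `|u| by rewrite ler_wpM2r// cf.
move=> h3; rewrite (le_trans h2)//.
have -> : f B' / 2 * `|u| = f B' * `|u| - f B' / 2 * `|u|.
  by rewrite -mulrBl [X in X - _]splitr addrK.
by rewrite lerBlDr (le_trans h3)// lerD2l.
Qed.

Lemma objective0 B y : objective A Sigma B y 0 = 0%E.
Proof.
rewrite (objectiveE A W)//.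
rewrite !linear0 normr0 expr0n mulr0 addr0 add0e.
by rewrite (@l1norm_finite _ _ 0)// ?big_ord0.
Qed.

Lemma objective_minimizer (Q : R) : 0 < Q -> exists2 M, 0 < M & exists N,
  forall B y, Bset B -> `|y| <= Q ->
    (exists u, minimizes (objective A Sigma B y) setT u) /\
    forall u, minimizes (objective A Sigma B y) setT u ->
      (l1norm u <= M%:E)%E /\ forall i, (N <= i)%N -> u i = 0.
Proof.
move=> Q0.
have [M M0 [N NP]] := objective_truncation A W Sigma Bset Sigma_inj S_sqrt SigmaW W_compact
  Bset_compact Q Q0.
exists M => //; exists N => B y BB yQ; split; last first.
  move=> u [_ umin].
  have Ju : (objective A Sigma B y u <= 0)%E by rewrite -(objective0 B y); exact: umin.
  have [lM Jt] := NP B y u BB yQ Ju; split => //.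
  move: (umin (l2_trunc N u) Logic.I) => Jtu.
  have ufin : l1norm u \is a fin_num.
    by rewrite ge0_fin_numE ?l1norm_ge0// (le_lt_trans lM)// ltry.
  have [r0 rfin] : (0 <= l1norm (u - l2_trunc N u)%R)%E /\
      l1norm (u - l2_trunc N u)%R \is a fin_num.
    split; first exact: l1norm_ge0.
    move: ufin; rewrite (l1norm_split N u) fin_numD => /andP[]//.
  have Jfin : objective A Sigma B y u \is a fin_num.
    by rewrite (objectiveE A W)// fin_numD ufin.
  (* The truncation gains half the l1 norm of the tail, while [u] is minimal; as all values are
     finite, the objective of the truncation cancels and the tail vanishes. *)
  have : (l1norm (u - l2_trunc N u)%R <= 0)%E.
    move: Jt Jtu r0; rewrite -(fineK rfin) -(fineK Jfin) /= -/(fine _).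
    case: (objective A Sigma B y (l2_trunc N u)) => [j| |]//.
    rewrite !lee_fin => h1 h2 _.
    have : j + 2^-1 * fine (l1norm (u - l2_trunc N u)%R) <= j := le_trans h1 h2.
    by rewrite gerDl pmulr_rle0.
  move=> r0' i Ni.
  have : (`|(u - l2_trunc N u)|%:E <= 0)%E := le_trans (l2_norm_le_l1norm _) r0'.
  rewrite lee_fin normr_le0 subr_eq0 => /eqP ->.
  by rewrite l2_truncE ltnNge Ni.
(* Existence: the objective attains its minimum over the box of coordinates bounded by [M], and this
   minimum is then shown to be global. *)
pose K := [set v : 'rV[R]_N | forall i, `[- M, M]%classic (v ord0 i)].
pose g v := 2^-1 * `|S (W (B (l2_of_rV N v)))| ^+ 2
  - inner y (W (B (l2_of_rV N v))) + \sum_(i < N) `|v ord0 i|.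
have gE v : objective A Sigma B y (l2_of_rV N v) = (g v)%:E.
  rewrite (objectiveE A W)// (@l1norm_finite _ _ N); last exact: l2_of_rV0.
  by rewrite /g EFinD; under eq_bigr do rewrite l2_of_rVE.
have [v0 v0K v0min] : exists2 c, c \in K & forall t, t \in K -> g c <= g t.
  apply: EVT_min_rV.
  - by exists 0 => i; rewrite mxE /= in_itv/= oppr_le0 ltW.
  - exact: rV_box_compact.
  apply: continuous_subspaceT => v.
  have cW := @bop_l2_of_rV_continuous _ _ (bop_comp W B) N v.
  have cSW := @bop_l2_of_rV_continuous _ _ (bop_comp S (bop_comp W B)) N v.
  apply: (cvgD (F := nbhs v)); last exact: sum_norm_rV_continuous.
  apply: (cvgB (F := nbhs v)).
    apply: (cvgM (F := nbhs v)); first exact: cvg_cst.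
    under eq_cvg do rewrite expr2.
    rewrite expr2; apply: (cvgM (F := nbhs v)); exact: (cvg_norm (F := nbhs v) cSW).
  under eq_cvg do rewrite innerC.
  rewrite innerC.
  exact: (continuous_comp cW (@inner_continuous _ _ y (W (B (l2_of_rV N v))))).
exists (l2_of_rV N v0); split => // u _.
rewrite gE.
(* A competitor with positive objective loses to 0, any other one to its own truncation; both of
   these come from the box. *)
have [Ju|/ltW Ju] := leP (objective A Sigma B y u) 0%E; last first.
  rewrite (le_trans _ Ju)//.
  have K0 : (0 : 'rV[R]_N) \in K.
    by rewrite inE => i; rewrite mxE /= in_itv/= oppr_le0 ltW.
  have := v0min _ K0; rewrite -lee_fin -(gE 0).
  suff -> : l2_of_rV N (0 : 'rV[R]_N) = 0 by rewrite objective0.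
  by rewrite /l2_of_rV big1// => i _; rewrite mxE scale0r.
have [lM Jt] := NP B y u BB yQ Ju.
have tK : (\row_(i < N) u i) \in K.
  rewrite inE => i; rewrite mxE /= in_itv/= -ler_norml.
  by rewrite (le_trans (l2_coord_le u i))// -lee_fin (le_trans _ lM)// l2_norm_le_l1norm.
have := v0min _ tK; rewrite -lee_fin -(gE (\row_(i < N) u i)).
have -> : l2_of_rV N (\row_(i < N) u i) = l2_trunc N u.
  by apply: eq_bigr => i _; rewrite mxE.
move=> /le_trans; apply; rewrite (le_trans _ Jt)// leeDl//.
by rewrite mule_ge0// ?lee_fin// l1norm_ge0.
Qed.

Lemma sqr_norm_midpoint (P : bop (l2 R) Y) (u v : l2 R) :
  `|P (2^-1 *: (u + v))| ^+ 2 =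
  2^-1 * `|P u| ^+ 2 + 2^-1 * `|P v| ^+ 2 - 4^-1 * `|P (v - u)| ^+ 2.
Proof.
rewrite bopZr bopDr bopBr !norm_inner innerZl innerZr.
rewrite !(innerBl, innerBr, innerDl, innerDr) (innerC (P v) (P u)); lra.
Qed.

Local Notation Jr N B y u := (2^-1 * `|S (W (B u))| ^+ 2 - inner y (W (B u))
  + \sum_(i < N) `|u i|).

(** Compares [u] with the midpoint of [u] and [v]. The parallelogram identity, halved by the factor
    1/2 of the quadratic term, leaves 1/8 of the squared distance, which becomes 1/4 once the
    inequality is multiplied by 2. *)
Lemma minimizer_strong N B y (u v : l2 R) :
  minimizes (objective A Sigma B y) setT u ->
  (forall i, (N <= i)%N -> u i = 0) -> (forall i, (N <= i)%N -> v i = 0) ->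
  Jr N B y u + 4^-1 * `|S (W (B (v - u)))| ^+ 2 <= Jr N B y v.
Proof.
move=> [_ umin] uN vN; pose w : l2 R := 2^-1 *: (u + v).
have wN i : (N <= i)%N -> w i = 0.
  by move=> Ni; rewrite l2Z l2D uN// vN// addr0 mulr0.
have := umin w Logic.I; rewrite !(objectiveE A W)// !(@l1norm_finite _ _ N)//.
rewrite lee_fin.
have -> : S (W (B w)) = bop_comp S (bop_comp W B) w by [].
rewrite sqr_norm_midpoint.
have -> : inner y (W (B w)) = 2^-1 * inner y (W (B u)) + 2^-1 * inner y (W (B v)).
  by rewrite !bopZr !bopDr innerZr innerDr mulrDr.
have : \sum_(i < N) `|w i| <= 2^-1 * \sum_(i < N) `|u i| + 2^-1 * \sum_(i < N) `|v i|.
  rewrite !mulr_sumr -big_split/=; apply: ler_sum => i _.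
  rewrite -mulrDr -[leLHS]/(`|2^-1 * (u i + v i)|) normrM ger0_norm// ler_pM2l//.
  exact: ler_normD.
move: (\sum_(i < N) `|w i|) (\sum_(i < N) `|u i|) (\sum_(i < N) `|v i|) => nw nu nv.
rewrite -![bop_comp S _ _]/(S (W (B _))).
move: (`|S (W (B (v - u)))|) (`|S (W (B u))|) (`|S (W (B v))|) => p q r.
move: (inner y (W (B u))) (inner y (W (B v))) => s t.
lra.
Qed.

(** Each minimizer is tested against the other one and the two inequalities are added. The l1 norms
    cancel, the left side is at least c^2 |u - u'|^2 / 2, and the right side is linear in u - u' and
    in the perturbation. Equal data give uniqueness of the minimizer. *)
Lemma minimizer_lipschitz (Q : R) : 0 < Q -> exists2 L, 0 < L &
  forall B B' y y' u u', Bset B -> Bset B' -> `|y| <= Q -> `|y'| <= Q ->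
    minimizes (objective A Sigma B y) setT u ->
    minimizes (objective A Sigma B' y') setT u' ->
    `|u - u'| <= L * (`|B - B'| + `|y - y'|).
Proof.
have arith1 (a1 a2 a3 e f g : R) : 0 <= a1 -> 0 <= a2 -> 0 <= a3 -> 0 <= e -> 0 <= f ->
    0 <= g -> a1 * (e * g) + (a2 * (f * g) + a3 * (e * g)) <= (a1 + a2 + a3 + 1) * (e + f) * g.
  move=> a10 a20 a30 e0 f0 g0.
  have eg := mulr_ge0 e0 g0; have fg := mulr_ge0 f0 g0.
  by have := mulr_ge0 a10 fg; have := mulr_ge0 a20 eg; have := mulr_ge0 a30 fg; lra.
have arith2 (a b v w z : R) : 2^-1 * a * b * v <= w * z -> v * a * b <= 2 * w * z.
  by lra.
move=> Q0; have [b b0 bB] := Bset_bounded Bset Bset_compact.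
have [M M0 [N NP]] := objective_minimizer Q Q0.
have [c c0 cP] := data_operator_uniformly_coercive N.
pose k := `|S| * `|W|.
have k0 : 0 <= k by rewrite mulr_ge0.
(* The first three terms are the coefficients found in [cross] (after halving) and [lin]; the last
   one keeps [L0] positive. *)
pose L0 := 2 * k ^+ 2 * b * M + `|W| * b + Q * `|W| + 1.
have a1 : 0 <= 2 * k ^+ 2 * b * M by rewrite !mulr_ge0 ?exprn_ge0// ltW.
have a2 : 0 <= `|W| * b by rewrite mulr_ge0// ltW.
have a3 : 0 <= Q * `|W| by rewrite mulr_ge0// ltW.
have L00 : 0 < L0 by rewrite ltr_wpDl// !addr_ge0.
exists (2 / c ^+ 2 * L0); first by rewrite mulr_gt0// divr_gt0// exprn_gt0.
move=> B B' y y' u u' BB BB' yQ yQ' umin umin'.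
have [_ /(_ u umin) [lu uN]] := NP B y BB yQ.
have [_ /(_ u' umin') [lu' uN']] := NP B' y' BB' yQ'.
have uM : `|u| <= M by rewrite -lee_fin (le_trans (l2_norm_le_l1norm u)).
have uM' : `|u'| <= M by rewrite -lee_fin (le_trans (l2_norm_le_l1norm u')).
have J1 := minimizer_strong N B y u u' umin uN uN'.
have J2 := minimizer_strong N B' y' u' u umin' uN' uN.
set d := u - u'; pose s := u + u'; pose E := B' - B.
have dN i : (N <= i)%N -> d i = 0 by move=> Ni; rewrite l2B uN// uN'// subrr.
have sM : `|s| <= 2 * M.
  by rewrite (le_trans (ler_normD _ _))// mulrDl mul1r lerD.
pose P (C : bop (l2 R) X) := bop_comp S (bop_comp W C).
have PE (C : bop (l2 R) X) (v : l2 R) : S (W (C v)) = P C v by [].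
have Pk C v : `|P C v| <= k * `|C| * `|v|.
  rewrite -PE (le_trans (bop_norm_le _ _))// /k -!mulrA ler_wpM2l//.
  by rewrite (le_trans (bop_norm_le _ _))// ler_wpM2l// bop_norm_le.
have Wk (C : bop (l2 R) X) (v : l2 R) : `|W (C v)| <= `|W| * `|C| * `|v|.
  by rewrite (le_trans (bop_norm_le _ _))// -!mulrA ler_wpM2l// bop_norm_le.
have PD v : P B' v = P B v + P E v.
  by rewrite -!PE -!bopDr bopB addrC subrK.
have WD v : W (B' v) = W (B v) + W (E v).
  by rewrite -bopDr bopB addrC subrK.
(* Factoring the difference of squares exposes one factor [d]; the other factor involves u + u' and
   is merely bounded. *)
have diff C : `|P C u'| ^+ 2 - `|P C u| ^+ 2 = - inner (P C d) (P C s).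
  rewrite !norm_inner /d /s bopBr bopDr.
  rewrite !(innerBl, innerBr, innerDl, innerDr) (innerC (P C u') (P C u)); ring.
have nd := normr_ge0 d; have nE := normr_ge0 E.
have cross : inner (P B' d) (P B' s) - inner (P B d) (P B s)
    <= 2 * (2 * k ^+ 2 * b * M) * (`|E| * `|d|).
  rewrite [X in inner X _](PD d) innerDl [in X in X + _ - _](PD s) innerDr.
  rewrite addrAC [_ + inner (P B d) (P E s)]addrC addrK.
  have h1 : inner (P B d) (P E s) <= (k * b * `|d|) * (k * `|E| * (2 * M)).
    rewrite (le_trans (ler_norm _))// (le_trans (cauchy_schwarz _ _))//.
    apply: ler_pM => //.
      rewrite (le_trans (Pk _ _))// ler_wpM2r// ler_wpM2l//; exact: bB.
    by rewrite (le_trans (Pk _ _))// ler_wpM2l// mulr_ge0.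
  have h2 : inner (P E d) (P B' s) <= (k * `|E| * `|d|) * (k * b * (2 * M)).
    rewrite (le_trans (ler_norm _))// (le_trans (cauchy_schwarz _ _))//.
    apply: ler_pM => //.
    rewrite (le_trans (Pk _ _))// ler_pM// ?mulr_ge0// ler_wpM2l//; exact: bB.
  rewrite (le_trans (lerD h1 h2))// le_eqVlt; apply/orP; left; apply/eqP; ring.
have lin : inner y (W (B d)) - inner y' (W (B' d))
    <= (`|W| * b) * (`|y - y'| * `|d|) + (Q * `|W|) * (`|E| * `|d|).
  rewrite WD innerDr opprD addrA -innerBl.
  have h1 : inner (y - y') (W (B d)) <= `|W| * b * (`|y - y'| * `|d|).
    rewrite (le_trans (ler_norm _))// (le_trans (cauchy_schwarz _ _))//.
    rewrite mulrCA ler_wpM2l// (le_trans (Wk _ _))// ler_wpM2r// ler_wpM2l//.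
    exact: bB.
  have h2 : - inner y' (W (E d)) <= Q * `|W| * (`|E| * `|d|).
    rewrite (le_trans (ler_norm _))// normrN (le_trans (cauchy_schwarz _ _))//.
    by rewrite -mulrA ler_pM// mulrA Wk.
  exact: lerD.
have main : 2^-1 * (c * `|d|) ^+ 2 <= L0 * (`|E| + `|y - y'|) * `|d|.
  have c1 := cP B d BB dN; have c2 := cP B' d BB' dN.
  have cd0 : 0 <= c * `|d| by rewrite mulr_ge0// ltW.
  have {}c1 : (c * `|d|) ^+ 2 <= `|P B d| ^+ 2 by rewrite ler_sqr ?nnegrE.
  have {}c2 : (c * `|d|) ^+ 2 <= `|P B' d| ^+ 2 by rewrite ler_sqr ?nnegrE.
  have e1 : inner y (W (B d)) = inner y (W (B u)) - inner y (W (B u')).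
    by rewrite /d !bopBr innerBr.
  have e2 : inner y' (W (B' d)) = inner y' (W (B' u)) - inner y' (W (B' u')).
    by rewrite /d !bopBr innerBr.
  have f1 := diff B; have f2 := diff B'.
  have J1' : `|S (W (B (u' - u)))| = `|P B d|.
    by rewrite PE /d -[u' - u]opprB linearN normrN.
  have L0E : L0 * (`|E| + `|y - y'|) * `|d| >=
    (2 * k ^+ 2 * b * M) * (`|E| * `|d|) +
    ((`|W| * b) * (`|y - y'| * `|d|) + (Q * `|W|) * (`|E| * `|d|)).
    exact: arith1.
  rewrite (le_trans _ L0E)//.
  rewrite J1' in J1; rewrite -/d in J2; rewrite !PE in J1 J2.
  move: J1 J2 c1 c2 e1 e2 f1 f2 cross lin.
  move: (\sum_(i < N) `|u i|) (\sum_(i < N) `|u' i|) => nu nu'.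
  lra.
have [d0|d0] := eqVneq d 0; first by
  rewrite d0 normr0 !mulr_ge0 ?invr_ge0 ?sqr_ge0 ?addr_ge0// ltW.
have nd0 : 0 < `|d| by rewrite normr_gt0.
rewrite [ `|B - B'|]distrC -/E; set z := `|E| + _ in main *.
have -> : 2 / c ^+ 2 * L0 * z = 2 * (L0 * z) / c ^+ 2 by ring.
rewrite ler_pdivlMr ?exprn_gt0//.
move: main; rewrite exprMn [ `|d| ^+ 2]expr2 !mulrA ler_pM2r//.
exact: arith2.
Qed.

Lemma reconstruct_lipschitz_W (Q : R) : 0 < Q ->
  exists L M : R, [/\ 0 < L, 0 < M & forall B B' y y', Bset B -> Bset B' ->
    `|y| <= Q -> `|y'| <= Q ->
    `|reconstruct A Sigma B y - reconstruct A Sigma B' y'|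
      <= L * (`|B - B'| + `|y - y'|) /\ `|reconstruct A Sigma B y| <= M].
Proof.
move=> Q0; have [b b0 bB] := Bset_bounded Bset Bset_compact.
have [M M0 [N NP]] := objective_minimizer Q Q0.
have [L L0 LP] := minimizer_lipschitz Q Q0.
exists (b * L + M), (b * M); split.
- by rewrite addr_gt0// mulr_gt0.
- by rewrite mulr_gt0.
move=> B B' y y' BB BB' yQ yQ'.
have [/getPex umin uP] := NP B y BB yQ.
have [/getPex umin' uP'] := NP B' y' BB' yQ'.
have [lu _] := uP _ umin; have [lu' _] := uP' _ umin'.
have := LP B B' y y' _ _ BB BB' yQ yQ' umin umin'.
move: lu lu'; rewrite /reconstruct -!/(uhat _ _ _ _).
move: (uhat A Sigma B y) (uhat A Sigma B' y') => u u' lu lu' uu'.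
have uM : `|u| <= M by rewrite -lee_fin (le_trans (l2_norm_le_l1norm u)).
have uM' : `|u'| <= M by rewrite -lee_fin (le_trans (l2_norm_le_l1norm u')).
split; last by rewrite (le_trans (bop_norm_le _ _))// ler_pM// bB.
have -> : B u - B' u' = B (u - u') + (B - B') u'.
  by rewrite bopB bopBr addrA subrK.
rewrite (le_trans (ler_normD _ _))// mulrDl lerD//.
  rewrite (le_trans (bop_norm_le _ _))// -mulrA; apply: ler_pM => //; exact: bB.
rewrite (le_trans (bop_norm_le _ _))// mulrC ler_pM//.
by rewrite lerDl.
Qed.

End reconstruction_lipschitz.

Lemma reconstruct_lipschitz {R : realType} {X Y : hilbertType R}
    (A : bop X Y) (Sigma : bop Y Y) (Bset : set (bop (l2 R) X))
    (Sigma_inj : injective Sigma)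
    (Sigma_sym : forall u v, inner (Sigma u) v = inner u (Sigma v))
    (Sigma_ge0 : forall u, 0 <= inner (Sigma u) u)
    (A_Sigma : range A `<=` range Sigma)
    (A_Sigma_compact : compact_operator (fun x => op_inv Sigma (A x)))
    (Bset_compact : compact Bset)
    (Bset_fbi : forall B, Bset B -> finite_basis_injective (A \o B))
    (Q : R) : 0 < Q ->
  exists L M : R, [/\ 0 < L, 0 < M & forall B B' y y', Bset B -> Bset B' ->
    `|y| <= Q -> `|y'| <= Q ->
    `|reconstruct A Sigma B y - reconstruct A Sigma B' y'|
      <= L * (`|B - B'| + `|y - y'|) /\ `|reconstruct A Sigma B y| <= M].
Proof.
have [W WE] := precompact_image_bounded _ A_Sigma_compact.
apply: (@reconstruct_lipschitz_W _ _ _ A W) => //.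
- exact: sqrt_op_exists.
- move=> x; rewrite -WE.
  have [v _ vx] : range Sigma (A x) by apply: A_Sigma; exists x.
  exact: (@getI _ [set w | Sigma w = A x] v).
- by case: A_Sigma_compact; rewrite WE.
Qed.

(** * Measurability and exponential moments *)

Lemma borel_open (T : ptopologicalType) (U : set T) :
  open U -> measurable (U : set (borel T)).
Proof. by move=> oO; exact: sub_sigma_algebra. Qed.

Lemma continuous_borel_measurable (S T : ptopologicalType) (f : S -> T) :
  continuous f -> measurable_fun [set: borel S] (f : borel S -> borel T).
Proof.
move=> /continuousP cf; apply: (measurability _ (erefl (@measurable _ (borel T)))).
by move=> _ [U oU <-]; rewrite setTI; apply: borel_open; exact: cf.
Qed.

(** The measurable structure is the product of the Borel sigma-algebras, so joint continuity of the
    distance does not suffice. By separability, |f - g| < x holds iff some dense point is within q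
    of f and within x - q of g for a rational q. *)
Lemma separable_measurable_dist (R : realType) (X : hilbertType R)
    (d : measure_display) (T : measurableType d) (f g : T -> borel X) :
  separable X -> measurable_fun setT f -> measurable_fun setT g ->
  measurable_fun setT (fun t => `|(f t : X) - (g t : X)|).
Proof.
move=> [D /pcard_geP[e] denseD] mf mg.
apply: (measurability _ (RGenInftyO.measurableE R)) => _ [_ [x ->] <-].
rewrite setTI.
rewrite (_ : _ @^-1` _ = \bigcup_n \bigcup_(q : rat)
    ((f @^-1` (ball (e n : X) (ratr q))) `&`
     (g @^-1` (ball (e n : X) (x - ratr q))))).
  apply: bigcupT_measurable => n; apply: bigcupT_measurable_rat => q.
  apply: measurableI; rewrite -[X in measurable X]setTI.
    by apply: mf => //; apply: borel_open; exact: ball_open.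
  by apply: mg => //; apply: borel_open; exact: ball_open.
apply/seteqP; split=> [t /=|t [n _ [q _ []]]]; last first.
  rewrite /= -ball_normE /= in_itv/= => fq gq.
  rewrite (le_lt_trans (ler_distD (e n : X) _ _))// distrC.
  by move: fq gq; clear; lra.
rewrite in_itv/= => fgx; set h := x - `|(f t : X) - g t|.
have h0 : 0 < h by rewrite subr_gt0.
have [|v [/= vf Dv]] := denseD (ball (f t : X) (h / 4)) _ (ball_open _ _).
  by exists (f t); apply: ballxx; rewrite divr_gt0.
have [n _ env] : range e v by exact: surj.
(* The dense point is within h / 4 < q of f, hence at distance below x - h + h / 4 from g, which is
   less than x - q since q < h / 2. *)
have [|q] := @rat_in_itvoo R (h / 4) (h / 2); first by move: h0; clear; lra.
rewrite in_itv/= => /andP[q4 q2].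
exists n => //; exists q => //; rewrite env; move: vf; rewrite -ball_normE/= => vf.
split.
  by rewrite distrC (lt_trans vf).
rewrite (le_lt_trans (ler_distD (f t : X) _ _))// distrC.
by move: vf q2 q4; rewrite /h; clear; lra.
Qed.

Section chernoff.
Context {R : realType}.

(** From exp (- y) >= 1 - y one gets exp y <= 1 / (1 - y), and (1 - y) (1 + y + 2 y^2) = 1 + y^2 (1
    - 2 y). *)
Lemma expR_le_quadratic (y : R) : `|y| <= 2^-1 -> expR y <= 1 + y + 2 * y ^+ 2.
Proof.
rewrite ler_norml => /andP[y1 y2].
have y0 : 0 < 1 - y by lra.
have : (1 - y) * expR y <= 1.
  rewrite -[leRHS](expRxMexpNx_1 y) mulrC ler_pM2l ?expR_gt0//.
  exact: expR_ge1Dx.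
rewrite -ler_pdivlMl// mulr1 => /le_trans; apply.
rewrite -[leLHS]mulr1 ler_pdivrMl//.
have : 0 <= y ^+ 2 * (1 - 2 * y) by rewrite mulr_ge0 ?sqr_ge0//; lra.
lra.
Qed.

Variables (I : finType) (p x : I -> R) (K : R).
Hypothesis p_ge0 : forall i, 0 <= p i.
Hypothesis p_sum1 : \sum_i p i = 1.
Hypothesis K_gt0 : 0 < K.
Hypothesis x_le : forall i, `|x i| <= K.
Hypothesis x_mean0 : \sum_i p i * x i = 0.

Lemma moment_generating_le (l : R) : 0 <= l -> l * K <= 2^-1 ->
  \sum_i p i * expR (l * x i) <= expR (2 * (l * K) ^+ 2).
Proof.
move=> l0 lK; rewrite (le_trans _ (expR_ge1Dx _))//.
apply: (@le_trans _ _
  (\sum_i (p i + l * (p i * x i) + 2 * (l * K) ^+ 2 * p i))).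
  apply: ler_sum => i _.
  have lx : `|l * x i| <= l * K by rewrite normrM ger0_norm// ler_wpM2l.
  have := expR_le_quadratic (l * x i) (le_trans lx lK).
  have lx2 : (l * x i) ^+ 2 <= (l * K) ^+ 2.
    by rewrite -real_normK ?num_real// ler_sqr ?nnegrE// (le_trans _ lx).
  move=> /(ler_wpM2l (p_ge0 i))/le_trans; apply.
  have := ler_wpM2l (p_ge0 i) lx2; lra.
rewrite !big_split/= -!mulr_sumr p_sum1 x_mean0; lra.
Qed.

Lemma finite_chernoff (m : nat) (s : R) : 0 < s -> s <= 2 * K ->
  \sum_(v : {ffun 'I_m -> I} | m%:R * s < \sum_j x (v j)) \prod_j p (v j)
  <= expR (- (m%:R * s ^+ 2 / (8 * K ^+ 2))).
Proof.
(* This [l] minimizes the exponent - l s + 2 (l K)^2, with value - s^2 / (8 K^2); the bound s <= 2 K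
   ensures l K <= 1/2. *)
move=> s0 sK; pose l := s / (4 * K ^+ 2).
have K2 : 0 < 4 * K ^+ 2 by rewrite mulr_gt0// exprn_gt0.
have l0 : 0 <= l by rewrite divr_ge0// ltW.
have lK : l * K <= 2^-1.
  have -> : l * K = s / (4 * K) by rewrite /l; field; rewrite gt_eqF.
  by rewrite ler_pdivrMr ?mulr_gt0//; lra.
apply: (@le_trans _ _ (\sum_(v : {ffun 'I_m -> I})
    expR (- (l * (m%:R * s))) * \prod_j (p (v j) * expR (l * x (v j))))).
  rewrite big_mkcond/=; apply: ler_sum => v _.
  rewrite big_split/= -expR_sum -mulr_sumr mulrCA -expRD.
  have P0 : 0 <= \prod_j p (v j) by exact: prodr_ge0.
  case: ifPn => [sv|_]; last by rewrite mulr_ge0// expR_ge0.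
  rewrite -[leLHS]mulr1 ler_wpM2l// -[leLHS]expR0 ler_expR.
  by rewrite addrC -mulrBr mulr_ge0// subr_ge0 ltW.
(* A sum over all functions of a product over the sample factorizes: the discrete form of
   independence. *)
rewrite -mulr_sumr -(bigA_distr_bigA (fun _ i => p i * expR (l * x i))).
rewrite prodr_const card_ord.
apply: (@le_trans _ _ (expR (- (l * (m%:R * s))) * expR (2 * (l * K) ^+ 2) ^+ m)).
  rewrite ler_wpM2l ?expR_ge0// lerXn2r ?nnegrE ?expR_ge0 ?moment_generating_le//.
  by apply: sumr_ge0 => i _; rewrite mulr_ge0 ?expR_ge0.
rewrite -expRM_natl -expRD ler_expR le_eqVlt; apply/orP; left; apply/eqP.
by rewrite /l; field; rewrite gt_eqF.
Qed.

End chernoff.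

(** * Concentration of empirical means *)

Section union_bound.
Context {R : realType} {d : measure_display} {T : measurableType d}.
Variables (mu : {measure set T -> \bar R}) (I : eqType) (F : I -> set T).
Hypothesis mF : forall i, measurable (F i).

Lemma measure_bigsetU_le (s : seq I) (P : pred I) :
  (mu (\big[setU/set0]_(i <- s | P i) F i) <= \sum_(i <- s | P i) mu (F i))%E.
Proof.
elim: s => [|i s ih]; first by rewrite !big_nil measure0.
rewrite !big_cons; case: ifPn => // Pi.
apply: (le_trans (measureU2 _ _ _)) => //; first exact: bigsetU_measurable.
exact: leeD.
Qed.

Lemma mem_bigsetU (s : seq I) (P : pred I) i w :
  i \in s -> P i -> F i w -> (\big[setU/set0]_(j <- s | P j) F j) w.
Proof.
elim: s => // j s ih; rewrite inE big_cons => /predU1P[<- ->|si Pi Fi]; first by left.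
by case: ifPn => _; [right|]; exact: ih.
Qed.

End union_bound.

Lemma probability_integral_cst {R : realType} {d : measure_display}
    {T : measurableType d} (mu : probability T R) (c : R) :
  (\int[mu]_z c%:E = c%:E)%E.
Proof. by rewrite integral_cst// [X in (_ * X)%E](probability_setT mu) mule1. Qed.

Section concentration.
Context {R : realType} {d : measure_display} {U : measurableType d}.
Variables (mu : probability U R) (f : U -> R) (K t : R).
Hypothesis mf : measurable_fun setT f.
Hypothesis K_gt0 : 0 < K.
Hypothesis f_ge0 : forall z, 0 <= f z.
Hypothesis f_le : forall z, f z <= K.
Hypothesis t_gt0 : 0 < t.
Hypothesis t_le : t <= K.

(** Mesh of the grid to which [f] is rounded down. Rounding costs at most [h], which together with a
    deviation t / 2 of the rounded mean stays below [t]. *)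
Let h := t / 4.
Let h_gt0 : 0 < h. Proof. by rewrite divr_gt0. Qed.
Let k := Num.truncn (K / h).
Let cell (v : 'I_k.+1) : set U := f @^-1` `[v%:R * h, v.+1%:R * h[.
Let p (v : 'I_k.+1) : R := fine (mu (cell v)).
Let idx z : 'I_k.+1 := inord (Num.truncn (f z / h)).
Let dbar : R := \sum_v p v * (v%:R * h).

Let m_cell v : measurable (cell v).
Proof. by rewrite /cell -[X in measurable X]setTI; apply: mf => //; exact: measurable_itv. Qed.

Let idxE z : idx z = Num.truncn (f z / h) :> nat.
Proof.
by rewrite /idx inordK// ltnS; apply: le_truncn; rewrite ler_pM2r ?invr_gt0.
Qed.

Let idx_itv z : (idx z)%:R * h <= f z < (idx z).+1%:R * h.
Proof.
have : 0 <= f z / h by rewrite divr_ge0// ltW.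
by move/truncn_itv; rewrite idxE ler_pdivlMr// ltr_pdivrMr.
Qed.

Let cell_idx z v : cell v z <-> idx z = v.
Proof.
rewrite /cell /= in_itv/=; split => [|<-]; last exact: idx_itv.
move=> fz; apply/val_inj; rewrite /= idxE; apply: truncn_def.
by rewrite ler_pdivlMr// ltr_pdivrMr.
Qed.

Let p_ge0 v : 0 <= p v. Proof. exact: fine_ge0. Qed.

Let mu_cell v : mu (cell v) = (p v)%:E.
Proof. by rewrite fineK// fin_num_measure. Qed.

Let integral_cells (a : 'I_k.+1 -> R) : (forall v, 0 <= a v) ->
  (\int[mu]_z (a (idx z))%:E = (\sum_v p v * a v)%:E)%E.
Proof.
move=> a0.
have aE z : (a (idx z))%:E = (\sum_v (a v)%:E * (\1_(cell v) z)%:E)%E.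
  rewrite (bigD1 (idx z))//= big1 => [|v vz].
    by rewrite indicE mem_set ?mule1 ?adde0//; exact/cell_idx.
  rewrite indicE memNset ?mule0// => /cell_idx vE.
  by rewrite vE eqxx in vz.
under eq_integral do rewrite aE.
rewrite ge0_integral_sum//; last first.
  by move=> v z _; rewrite -EFinM lee_fin mulr_ge0.
  move=> v; apply: emeasurable_funM => //.
  by apply/measurable_EFinP; exact: measurable_indic.
rewrite -sumEFin; apply: eq_bigr => v _.
rewrite ge0_integralZl_EFin//; last first.
  by apply/measurable_EFinP; exact: measurable_indic.
by rewrite integral_indic// setIT [X in (_ * X)%E](mu_cell v) -EFinM mulrC.
Qed.

Let p_sum1 : \sum_v p v = 1.
Proof.
have := integral_cells (fun=> 1) (fun _ => ler01).
rewrite probability_integral_cst => -[e]; rewrite [RHS]e.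
by apply: eq_bigr => v _; rewrite mulr1.
Qed.

Let m_idx (a : 'I_k.+1 -> R) : measurable_fun setT (fun z => a (idx z)).
Proof.
move=> _ B mB; rewrite setTI.
rewrite (_ : _ @^-1` _ = \big[setU/set0]_(v | a v \in B) cell v).
  exact: bigsetU_measurable.
apply/seteqP; split => z /=.
  move=> Bz; apply: (@mem_bigsetU _ _ _ cell _ _ (idx z)).
  - by rewrite mem_index_enum.
  - exact: mem_set.
  - exact/cell_idx.
by rewrite -bigcup_seq_cond => -[v /= /andP[_ /set_mem Bv] /cell_idx ->].
Qed.

Lemma integral_bounded_fin_num : (\int[mu]_z (f z)%:E)%E \is a fin_num.
Proof.
rewrite ge0_fin_numE; last by apply: integral_ge0 => z _; rewrite lee_fin.
apply: (@le_lt_trans _ _ (\int[mu]_z K%:E)%E); last first.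
  by rewrite probability_integral_cst ltry.
apply: ge0_le_integral => //; first by move=> z _; rewrite lee_fin.
- exact/measurable_EFinP.
- by move=> z _; rewrite lee_fin.
Qed.

Let dbar_itv : dbar <= fine (\int[mu]_z (f z)%:E)%E <= dbar + h.
Proof.
have fin := integral_bounded_fin_num.
have a0 (v : 'I_k.+1) : 0 <= v%:R * h by rewrite mulr_ge0// ltW.
have a1 (v : 'I_k.+1) : 0 <= v%:R * h + h by rewrite addr_ge0// ltW.
apply/andP; split; rewrite -lee_fin fineK//.
  rewrite /dbar -(integral_cells (fun v : 'I_k.+1 => v%:R * h) a0).
  apply: ge0_le_integral => //.
  - by move=> z _; rewrite lee_fin.
  - apply/measurable_EFinP; exact: (m_idx (fun v : 'I_k.+1 => v%:R * h)).
  - exact/measurable_EFinP.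
  - by move=> z _; rewrite lee_fin; have /andP[] := idx_itv z.
have -> : dbar + h = \sum_v p v * (v%:R * h + h).
  under [RHS]eq_bigr do rewrite mulrDr.
  by rewrite big_split/= -mulr_suml p_sum1 mul1r.
rewrite -(integral_cells (fun v : 'I_k.+1 => v%:R * h + h) a1).
apply: ge0_le_integral => //.
- by move=> z _; rewrite lee_fin.
- exact/measurable_EFinP.
- apply/measurable_EFinP; exact: (m_idx (fun v : 'I_k.+1 => v%:R * h + h)).
- move=> z _; rewrite lee_fin; have /andP[_ /ltW] := idx_itv z.
  by rewrite -natr1 mulrDl mul1r.
Qed.

Let x (v : 'I_k.+1) : R := v%:R * h - dbar.

Let val_le (v : 'I_k.+1) : 0 <= v%:R * h <= K.
Proof.
rewrite mulr_ge0 ?(ltW h_gt0)//= -ler_pdivlMr//.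
have : 0 <= K / h by rewrite divr_ge0// ltW.
by move/truncn_itv/andP => [+ _]; apply: le_trans; rewrite ler_nat -ltnS.
Qed.

Let x_le v : `|x v| <= K.
Proof.
have /andP[v0 vK] := val_le v.
have d0 : 0 <= dbar by apply: sumr_ge0 => w _; rewrite mulr_ge0//; have /andP[] := val_le w.
have dK : dbar <= K.
  rewrite -[leRHS]mul1r -p_sum1 mulr_suml; apply: ler_sum => w _.
  by rewrite ler_wpM2l//; have /andP[] := val_le w.
by rewrite ler_norml /x; apply/andP; split; lra.
Qed.

Let x_mean : \sum_v p v * x v = 0.
Proof.
rewrite /x; under eq_bigr do rewrite mulrBr.
by rewrite sumrB -mulr_suml p_sum1 mul1r subrr.
Qed.

Lemma empirical_mean_concentration (d' : measure_display)
    (Omega : measurableType d') (P : probability Omega R) (m : nat)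
    (z : 'I_m -> Omega -> U) : (0 < m)%N -> iid_sample P z mu ->
  exists F : set Omega, [/\ measurable F,
    (P F <= (2 * expR (- (m%:R * t ^+ 2 / (32 * K ^+ 2))))%:E)%E &
    forall w, ~ F w ->
      `|m%:R^-1 * (\sum_j f (z j w)) - fine (\int[mu]_u (f u)%:E)%E| <= t].
Proof.
move=> m0 [zlaw zind].
(* [v] records the cell of each observation; by independence its probability is the product summed
   in [finite_chernoff]. Applied with deviation t / 2, that bound turns 8 K^2 into 32 K^2. *)
pose G (v : {ffun 'I_m -> 'I_k.+1}) := \bigcap_(j in [set` [set: 'I_m]%SET]) z j @^-1` cell (v j).
have mG v : measurable (G v).
  apply: fin_bigcap_measurable => // j _; have [mz _] := zlaw j.
  by rewrite -[X in measurable X]setTI; exact: mz.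
have PG v : P (G v) = (\prod_j p (v j))%:E.
  rewrite /G zind// -prodEFin; apply: eq_big => [j|j _]; first by rewrite inE.
  by have [_ ->] := zlaw j.
have mR : 0 < m%:R :> R by rewrite ltr0n.
have t2 : 0 < t / 2 by rewrite divr_gt0.
have t2K : t / 2 <= 2 * K by have := t_le; have := t_gt0; lra.
pose bad (y : 'I_k.+1 -> R) (v : {ffun 'I_m -> 'I_k.+1}) :=
  m%:R * (t / 2) < \sum_j y (v j).
pose F y := \big[setU/set0]_(v | bad y v) G v.
have mFy y : measurable (F y) by exact: bigsetU_measurable.
have PF y : (forall v, `|y v| <= K) -> \sum_v p v * y v = 0 ->
    (P (F y) <= (expR (- (m%:R * t ^+ 2 / (32 * K ^+ 2))))%:E)%E.
  move=> yK y0; apply: (le_trans (measure_bigsetU_le _ _ _ mG _ _)).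
  rewrite (eq_bigr (fun v : {ffun 'I_m -> 'I_k.+1} => (\prod_j p (v j))%:E)%E); last first.
    by move=> v _; exact: PG.
  rewrite sumEFin lee_fin.
  have := @finite_chernoff _ _ p y K p_ge0 p_sum1 K_gt0 yK y0 m (t / 2) t2 t2K.
  move=> /le_trans; apply; rewrite le_eqVlt; apply/orP; left; apply/eqP.
  by congr expR; field; rewrite gt_eqF.
exists (F x `|` F (fun v => - x v)); split.
- exact: measurableU.
- apply: (le_trans (measureU2 _ _ _)) => //.
  rewrite mulrDl mul1r EFinD; apply: leeD; apply: PF => // [v|].
    by rewrite normrN.
  by under eq_bigr do rewrite mulrN; rewrite sumrN x_mean oppr0.
move=> w /not_orP[nF1 nF2].
pose v : {ffun 'I_m -> 'I_k.+1} := [ffun j => idx (z j w)].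
have Gv : G v w by move=> j _ /=; apply/cell_idx; rewrite ffunE.
have good y : ~ F y w -> \sum_j y (v j) <= m%:R * (t / 2).
  move=> nF; rewrite leNgt; apply/negP => badv; apply: nF.
  by apply: (@mem_bigsetU _ _ _ G _ _ v) => //; rewrite mem_index_enum.
have {}nF1 := good _ nF1; have {}nF2 := good _ nF2.
rewrite sumrN in nF2.
have /andP[d1 d2] := dbar_itv.
have xE : \sum_j x (v j) = \sum_j (v j)%:R * h - m%:R * dbar.
  by rewrite sumrB sumr_const card_ord mulr_natl.
have s1 : \sum_j (v j)%:R * h <= \sum_j f (z j w).
  by apply: ler_sum => j _; rewrite ffunE; have /andP[] := idx_itv (z j w).
have s2 : \sum_j f (z j w) <= \sum_j (v j)%:R * h + m%:R * h.
  rewrite -[X in _ + X](_ : \sum_(j < m) h = _); last first.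
    by rewrite sumr_const card_ord mulr_natl.
  rewrite -big_split/=; apply: ler_sum => j _; rewrite ffunE.
  have /andP[_ /ltW] := idx_itv (z j w).
  by rewrite -natr1 mulrDl mul1r.
move: (fine _) d1 d2 => e d1 d2.
have e1 : m%:R * dbar <= m%:R * e by rewrite ler_pM2l.
have e2 : m%:R * e <= m%:R * dbar + m%:R * h by rewrite -mulrDr ler_pM2l.
rewrite xE in nF1 nF2.
have e3 : m%:R * h = m%:R * t / 4 by rewrite /h mulrA.
have e4 : m%:R * (t / 2) = m%:R * t / 2 by rewrite mulrA.
have e5 : 0 < m%:R * t by rewrite mulr_gt0.
rewrite e3 in s2 e2; rewrite e4 in nF1 nF2.
set s := \sum_j f (z j w) in s1 s2 *.
have -> : m%:R^-1 * s - e = m%:R^-1 * (s - m%:R * e).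
  by rewrite mulrBr mulKf// gt_eqF.
rewrite normrM gtr0_norm ?invr_gt0// ler_pdivrMl// ler_norml.
by apply/andP; split; lra.
Qed.

End concentration.

(** * Uniform deviation over a covering *)

Section uniform_deviation.
Context {R : realType} {V : normedModType R} {d : measure_display}
  {U : measurableType d}.
Variables (S : set V) (mu : probability U R) (f : V -> U -> R) (K L : R).
Hypothesis K_gt0 : 0 < K.
Hypothesis L_ge0 : 0 <= L.
Hypothesis mf : forall b, S b -> measurable_fun setT (f b).
Hypothesis f_itv : forall b u, S b -> 0 <= f b u <= K.
Hypothesis f_lip : forall b c u, S b -> S c -> `|f b u - f c u| <= L * `|b - c|.

Local Notation mean b := (fine (\int[mu]_u (f b u)%:E)%E).
Local Notation emp m z b w := (m%:R^-1 * \sum_(j < m) f b (z j w)).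

Lemma mean_integral_fin_num b : S b -> (\int[mu]_u (f b u)%:E)%E \is a fin_num.
Proof.
move=> Sb; apply: (integral_bounded_fin_num mu (f b) K (mf b Sb)) => u.
  by have /andP[] := f_itv b u Sb.
by have /andP[] := f_itv b u Sb.
Qed.

Lemma mean_lipschitz b c : S b -> S c -> `|mean b - mean c| <= L * `|b - c|.
Proof.
suff H b' c' : S b' -> S c' -> mean b' <= mean c' + L * `|b' - c'|.
  move=> Sb Sc; have := H b c Sb Sc; have := H c b Sc Sb; rewrite (distrC c b).
  by move=> h1 h2; rewrite ler_norml; apply/andP; split; lra.
move=> Sb Sc; rewrite -lee_fin EFinD !fineK ?mean_integral_fin_num//.
rewrite -(probability_integral_cst mu (L * _)) -ge0_integralD//.
- apply: ge0_le_integral => //.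
  + by move=> u _; rewrite lee_fin; have /andP[] := f_itv b' u Sb.
  + by apply/measurable_EFinP; exact: mf.
  + by apply: emeasurable_funD => //; apply/measurable_EFinP; exact: mf.
  + move=> u _; rewrite -EFinD lee_fin -lerBlDl.
    exact: (le_trans (ler_norm _) (f_lip _ _ _ Sb Sc)).
- by move=> u _; rewrite lee_fin; have /andP[] := f_itv c' u Sc.
- by apply/measurable_EFinP; exact: mf.
- by move=> u _; rewrite lee_fin mulr_ge0.
Qed.

Lemma empirical_mean_lipschitz (Omega : Type) m (z : 'I_m -> Omega -> U) w b c :
  (0 < m)%N -> S b -> S c -> `|emp m z b w - emp m z c w| <= L * `|b - c|.
Proof.
move=> m0 Sb Sc; have mR : 0 < m%:R :> R by rewrite ltr0n.
rewrite -mulrBr -sumrB normrM gtr0_norm ?invr_gt0// ler_pdivrMl//.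
rewrite (le_trans (ler_norm_sum _ _ _))//.
rewrite (le_trans (ler_sum _ (fun j _ => f_lip b c (z j w) Sb Sc)))//.
by rewrite sumr_const card_ord mulr_natl.
Qed.

(** Concentration is used at one point of [S] per ball, since the centres may lie outside [S]. Such
    a point is within 2 r of any point of [S] in its ball, and both the empirical and the true mean
    pay [L * (2 * r)]. *)
Lemma uniform_deviation (t r : R) (n : nat) : 0 < t -> t <= K ->
  Defs.covered_by S r n ->
  forall (d' : measure_display) (Omega : measurableType d')
    (P : probability Omega R) (m : nat) (z : 'I_m -> Omega -> U),
  (0 < m)%N -> iid_sample P z mu ->
  exists F : set Omega, [/\ measurable F,
    (P F <= (n%:R * (2 * expR (- (m%:R * t ^+ 2 / (32 * K ^+ 2)))))%:E)%E &
    forall w b, ~ F w -> S b ->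
      `|emp m z b w - mean b| <= t + 4 * L * r].
Proof.
move=> t0 tK [c cS] d' Omega P m z m0 zmu.
pose q := 2 * expR (- (m%:R * t ^+ 2 / (32 * K ^+ 2))).
have q0 : 0 <= q by rewrite mulr_ge0// expR_ge0.
have /choice[b bP] : forall i : 'I_n, exists b, (exists2 a, S a & ball (c i) r a) ->
    S b /\ ball (c i) r b.
  move=> i; have [[a Sa ca]|na] := pselect (exists2 a, S a & ball (c i) r a).
    by exists a.
  by exists 0.
have /choice[F FP] : forall i : 'I_n, exists F : set Omega, [/\ measurable F,
    (P F <= q%:E)%E & S (b i) -> forall w, ~ F w -> `|emp m z (b i) w - mean (b i)| <= t].
  (* A ball that misses [S] contributes an empty exceptional event. *)
  move=> i; have [Sb|nSb] := pselect (S (b i)); last first.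
    by exists set0; split; rewrite ?measure0.
  have [||F [mF PF Fw]] := @empirical_mean_concentration _ _ _ mu (f (b i)) K t
      (mf _ Sb) K_gt0 _ _ t0 tK _ _ P m z m0 zmu.
  - by move=> u; have /andP[] := f_itv _ u Sb.
  - by move=> u; have /andP[] := f_itv _ u Sb.
  by exists F.
have mF i : measurable (F i) by have [] := FP i.
exists (\big[setU/set0]_(i < n) F i); split.
- exact: bigsetU_measurable.
- apply: (le_trans (measure_bigsetU_le P _ F mF _ _)).
  apply: (@le_trans _ _ (\sum_(i < n) q%:E)%E).
    by apply: lee_sum => i _; have [] := FP i.
  by rewrite sumEFin lee_fin sumr_const card_ord mulr_natl.
move=> w a nFw Sa.
have [i _ ia] := cS a Sa.
have [Sb ib] := bP i (ex_intro2 _ _ a Sa ia).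
have nF : ~ F i w.
  move=> Fi; apply: nFw; apply: (@mem_bigsetU _ _ _ F _ _ i) => //.
  by rewrite mem_index_enum.
have [_ _ /(_ Sb w nF) dev] := FP i.
have ab : `|a - b i| <= 2 * r.
  rewrite (le_trans (ler_distD (c i) _ _))// distrC.
  by move: ia ib; rewrite -ball_normE /= => /ltW ia /ltW ib; lra.
have Lab : L * `|a - b i| <= L * (2 * r) by rewrite ler_wpM2l.
have e1 := empirical_mean_lipschitz _ m z w a (b i) m0 Sa Sb.
have e2 := mean_lipschitz a (b i) Sa Sb.
move: dev e1 e2; rewrite !ler_norml => /andP[? ?] /andP[? ?] /andP[? ?].
by apply/andP; split; lra.
Qed.

End uniform_deviation.

(** Compactness yields a finite cover, so the minimum selected by [get] exists and is not a default
    value. *)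
Lemma covering_number_covered {R : realType} {V : normedModType R} (S : set V) (r : R) :
  compact S -> 0 < r -> Defs.covered_by S r (covering_number S r).
Proof.
move=> Scpt r0.
have [s [_ sP]] := compact_finite_net _ (fun=> r) Scpt (fun _ _ => r0).
have ex : exists n, `[< Defs.covered_by S r n >].
  exists (size s); apply/asboolP; exists (fun i => nth 0 s i) => x Sx.
  have [c cs cx] := sP x Sx.
  have cI : (index c s < size s)%N by rewrite index_mem.
  by exists (Ordinal cI) => //=; rewrite nth_index// -ball_normE.
have : (Defs.covered_by S r (ex_minn ex) /\ forall k, Defs.covered_by S r k -> (ex_minn ex <= k)%N).
  case: ex_minnP => n /asboolP cn nmin; split => // k ck.
  by apply: nmin; exact/asboolP.
by move=> /(@getI _ [set n | Defs.covered_by S r n /\ forall k,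
  Defs.covered_by S r k -> (n <= k)%N] (ex_minn ex))/=[].
Qed.

(** * Excess risk *)

Lemma borel_norm_le_measurable {R : realType} (X : hilbertType R) (q : R) :
  measurable ([set x | `|x : X| <= q] : set (borel X)).
Proof.
rewrite -[X in measurable X]setCK; apply: measurableC; apply: borel_open.
apply: closed_openC.
apply: (@preimage_closed _ _ (fun x : X => `|x|) [set r | r <= q]).
  by move=> v _; exact: norm_continuous.
exact: closed_le.
Qed.

Section excess_risk.
Context {R : realType} {X Y : hilbertType R}.
Variables (A : bop X Y) (Sigma : bop Y Y) (Bset : set (bop (l2 R) X)) (Q0 : R).
Hypothesis sepX : separable X.
Hypothesis Sigma_inj : injective Sigma.
Hypothesis Sigma_sym : forall u v, inner (Sigma u) v = inner u (Sigma v).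
Hypothesis Sigma_ge0 : forall u, 0 <= inner (Sigma u) u.
Hypothesis A_Sigma : range A `<=` range Sigma.
Hypothesis A_Sigma_compact : compact_operator (fun x => op_inv Sigma (A x)).
Hypothesis Bset_compact : compact Bset.
Hypothesis Bset_fbi : forall B, Bset B -> finite_basis_injective (A \o B).
Hypothesis Q0_gt0 : 0 < Q0.

(** The Lipschitz constant depends on a bound on the data, so it is taken on the ball of radius |y|
    + 1, which contains a neighbourhood of [y]. *)
Lemma reconstruct_continuous B : Bset B -> continuous (reconstruct A Sigma B).
Proof.
move=> BB y.
have Q1 : 0 < `|y| + 1 by rewrite ltr_wpDl.
have [L [M [L0 _ H]]] := reconstruct_lipschitz A Sigma Bset Sigma_inj Sigma_sym
  Sigma_ge0 A_Sigma A_Sigma_compact Bset_compact Bset_fbi _ Q1.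
apply/cvgrPdist_le => e e0; apply/nbhs_normP => /=.
exists (Num.min 1 (e / L)); first by rewrite /= lt_min ltr01 divr_gt0.
move=> y' /=; rewrite lt_min => /andP[yy1 yyL].
have yQ : `|y| <= `|y| + 1 by rewrite lerDl.
have yQ' : `|y'| <= `|y| + 1.
  rewrite -(subrK y y') (le_trans (ler_normD _ _))// addrC lerD2l distrC.
  exact: ltW.
have [+ _] := H B B y y' BB BB yQ yQ'.
rewrite subrr normr0 add0r => /le_trans; apply.
by rewrite mulrC -ler_pdivlMr// ltW.
Qed.

Let Q1 := (`|A| + 1) * Q0.

Let good : set (borel X * borel Y) := [set z | `|z.1 : X| <= Q0 /\ `|z.2 : Y| <= Q1].

Let m_good : measurable good.
Proof.
have -> : good = (fst @^-1` [set x | `|x : X| <= Q0]) `&` (snd @^-1` [set y | `|y : Y| <= Q1]).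
  by [].
apply: measurableI; rewrite -[X in measurable X]setTI.
  by apply: measurable_fst => //; exact: borel_norm_le_measurable.
by apply: measurable_snd => //; exact: borel_norm_le_measurable.
Qed.

Let loss (B : bop (l2 R) X) (z : borel X * borel Y) : R :=
  `|reconstruct A Sigma B z.2 - (z.1 : X)| ^+ 2.

Let m_loss B : Bset B -> measurable_fun setT (loss B).
Proof.
move=> BB; apply: measurable_funX.
apply: (separable_measurable_dist _ _ _ _
  (fun z : borel X * borel Y => reconstruct A Sigma B z.2 : borel X) fst) => //.
apply: (measurableT_comp (f := (reconstruct A Sigma B : borel Y -> borel X))) => //.
by apply: continuous_borel_measurable; exact: reconstruct_continuous.
Qed.

(** Since [Bhat] minimizes the empirical risk, the excess risk is at most twice the uniform
    deviation t + 4 L r. [K] and [L] come before the law of the data, as the final constants must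
    not depend on it. *)
Lemma excess_risk_bound : exists K L : R, [/\ 0 < K, 0 < L &
  forall (d : measure_display) (Omega : measurableType d)
    (P : probability Omega R) (x : Omega -> X) (eps : Omega -> Y)
    (rho : probability (borel X * borel Y)%type R),
    {ae P, forall w, `|x w| <= Q0} -> {ae P, forall w, `|eps w| <= Q0} ->
    has_law P (fun w => (x w, A (x w) + eps w) : borel X * borel Y) rho ->
  forall (t r : R) (n : nat), 0 < t -> t <= K -> Defs.covered_by Bset r n ->
  forall (d' : measure_display) (Omega' : measurableType d')
    (P' : probability Omega' R) (m : nat)
    (z : 'I_m -> Omega' -> borel X * borel Y), (0 < m)%N ->
    iid_sample P' z rho ->
  forall (Bhat : Omega' -> bop (l2 R) X) (Bstar : bop (l2 R) X), Bset Bstar ->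
    {ae P', forall w,
      minimizes (empirical_risk A Sigma (fun j => z j w)) Bset (Bhat w)} ->
  exists E : set Omega', [/\ measurable E,
    E `<=` [set w |
      (risk A Sigma rho (Bhat w) - risk A Sigma rho Bstar
       <= (2 * t + 8 * L * r)%:E)%E] &
    ((1 - n%:R * (2 * expR (- (m%:R * t ^+ 2 / (32 * K ^+ 2)))))%:E <= P' E)%E]].
Proof.
have Q1_gt0 : 0 < Q1 by rewrite mulr_gt0// ltr_wpDl.
have [L0 [M [L00 M0 H]]] := reconstruct_lipschitz A Sigma Bset Sigma_inj Sigma_sym
  Sigma_ge0 A_Sigma A_Sigma_compact Bset_compact Bset_fbi _ Q1_gt0.
pose c := M + Q0; have c0 : 0 < c by rewrite addr_gt0.
pose K := c ^+ 2; have K0 : 0 < K by rewrite exprn_gt0.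
(* From a^2 - b^2 = (a - b) (a + b), where both norms are at most [c] on [good]. *)
pose L := L0 * (2 * c); have L_gt0 : 0 < L by rewrite !mulr_gt0.
exists K, L; split => // d Omega P x eps rho xQ epsQ xlaw t r n t0 tK cov.
move=> d' Omega' P' m z m0 zrho Bhat Bstar BBstar Bhatmin.
(* The cut-off loss is bounded and Lipschitz everywhere, and equals the loss almost surely, hence in
   both risks off a null event. *)
pose f B u := loss B u * \1_good u.
have dist_le B u : Bset B -> good u -> `|reconstruct A Sigma B u.2 - (u.1 : X)| <= c.
  move=> BB [u1 u2]; have [_ RM] := H B B u.2 u.2 BB BB u2 u2.
  by rewrite (le_trans (ler_normB _ _))// lerD.
have mf B : Bset B -> measurable_fun setT (f B).
  move=> BB; apply: measurable_funM; first exact: m_loss.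
  exact: measurable_indic.
have f_itv B u : Bset B -> 0 <= f B u <= K.
  move=> BB; rewrite /f indicE; case: (boolP (u \in good)) => [/set_mem gu|_].
    rewrite mulr1 sqr_ge0/= ler_sqr ?nnegrE// ?(ltW c0)//; exact: dist_le.
  by rewrite mulr0 lexx ltW.
have f_lip B B' u : Bset B -> Bset B' -> `|f B u - f B' u| <= L * `|B - B'|.
  move=> BB BB'; rewrite /f indicE; case: (boolP (u \in good)) => [/set_mem gu|_].
    rewrite !mulr1 /loss subr_sqr normrM.
    have h1 := dist_le B u BB gu; have h2 := dist_le B' u BB' gu.
    have [u1 u2] := gu; have [h3 _] := H B B' u.2 u.2 BB BB' u2 u2.
    rewrite /L mulrAC; apply: ler_pM => //.
      rewrite (le_trans (ler_dist_dist _ _))//.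
      rewrite opprB addrA subrK (le_trans h3)// subrr normr0 addr0//.
    by rewrite ger0_norm ?addr_ge0// mulrDl mul1r lerD.
  by rewrite !mulr0 subrr normr0 mulr_ge0// ltW.
have rho_bad : rho (~` good) = 0.
  have [mxy xyrho] := xlaw.
  have mbad : measurable (~` good) by exact: measurableC.
  rewrite -xyrho//.
  have mpre : measurable ((fun w => (x w, A (x w) + eps w) : borel X * borel Y)
      @^-1` (~` good)).
    by rewrite -[X in measurable X]setTI; exact: mxy.
  apply/(negligibleP _ mpre).
  have : {ae P, forall w, good (x w, A (x w) + eps w)}.
    near=> w; split => /=.
      by near: w.
    have xw : `|x w| <= Q0 by near: w.
    have ew : `|eps w| <= Q0 by near: w.
    rewrite (le_trans (ler_normD _ _))// /Q1 mulrDl mul1r lerD//.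
    by rewrite (le_trans (bop_norm_le _ _))// ler_wpM2l.
  by apply.
have riskE B : Bset B -> risk A Sigma rho B = (\int[rho]_u (f B u)%:E)%E.
  move=> BB; rewrite /risk unlock; apply: ge0_ae_eq_integral => //.
  - by apply/measurable_EFinP; exact: m_loss.
  - by apply/measurable_EFinP; exact: mf.
  - by move=> u _; rewrite lee_fin; have /andP[] := f_itv B u BB.
  exists (~` good); split => //; first exact: measurableC.
  move=> u /= hu gu; apply: hu => _.
  by rewrite /f indicE mem_set// mulr1.
have [F [mF PF dev]] := uniform_deviation Bset rho f K L K0 (ltW L_gt0) mf f_itv f_lip
  t r n t0 tK cov d' Omega' P' m z m0 zrho.
have [N [mN N0 Nmin]] := Bhatmin.
pose D := \big[setU/set0]_(j < m) (z j @^-1` (~` good)).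
have mzbad j : measurable (z j @^-1` (~` good)).
  have [[mz _] _] := (zrho.1 j, tt).
  by rewrite -[X in measurable X]setTI; apply: mz => //; exact: measurableC.
have mD : measurable D by exact: bigsetU_measurable.
have D0 : P' D = 0.
  apply/eqP; rewrite eq_le measure_ge0 andbT.
  apply: (le_trans (measure_bigsetU_le P' _ _ mzbad _ _)).
  rewrite big1// => j _; have [_ zE] := zrho.1 j.
  exact: (etrans (zE _ (measurableC m_good)) rho_bad).
(* Excluded are large deviations, the null set where [Bhat] may fail to minimize, and the null set
   of samples that leave [good]. *)
exists (~` (F `|` (N `|` D))); split.
- by apply: measurableC; apply: measurableU => //; exact: measurableU.
- move=> w /not_orP[nF /not_orP[nN nD]] /=.
  have [BBhat hatmin] : minimizes (empirical_risk A Sigma (fun j => z j w)) Bset (Bhat w).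
    by apply: contrapT => nm; apply: nN; exact: Nmin.
  have zgood j : good (z j w).
    apply: contrapT => nz; apply: nD.
    apply: (@mem_bigsetU _ _ _ (fun j => z j @^-1` (~` good)) _ _ j) => //.
    by rewrite mem_index_enum.
  have empE B : empirical_risk A Sigma (fun j => z j w) B
      = m%:R^-1 * \sum_(j < m) f B (z j w).
    congr (_ * _); apply: eq_bigr => j _.
    by rewrite /f indicE mem_set// mulr1.
  have := hatmin Bstar BBstar; rewrite !empE => hat_le.
  have d1 := dev w _ nF BBhat; have d2 := dev w _ nF BBstar.
  rewrite !riskE//.
  have fin B : Bset B -> (\int[rho]_u (f B u)%:E)%E \is a fin_num.
    by move=> BB; exact: (mean_integral_fin_num Bset rho f K mf f_itv).
  rewrite -(fineK (fin _ BBhat)) -(fineK (fin _ BBstar)) lee_fin.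
  move: d1 d2; rewrite !ler_norml => /andP[d1 d1'] /andP[d2 d2'].
  have {}hat_le : (m%:R^-1 * (\sum_(j < m) f (Bhat w) (z j w)) <=
    m%:R^-1 * (\sum_(j < m) f Bstar (z j w)) :> R) := hat_le.
  by lra.
- rewrite probability_setC; last by apply: measurableU => //; exact: measurableU.
  rewrite EFinB leeB//; apply: (le_trans (measureU2 _ _ _)) => //.
    exact: measurableU.
  have PND : P' (N `|` D) = 0.
    apply/eqP; rewrite eq_le measure_ge0 andbT.
    apply: (le_trans (measureU2 _ _ _)) => //.
    by rewrite [X in (X + _)%E]N0 [X in (_ + X)%E]D0 adde0.
  by rewrite [X in (_ + X)%E]PND adde0.
Unshelve. all: by end_near. Qed.

End excess_risk.

(** * Rates *)

Section rates.
Context {R : realType}.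
Implicit Types (s T : R) (m n : nat).

Lemma powR_sqrt_unbounded (a T : R) : 0 < a ->
  exists m0, forall m, (m0 <= m)%N -> T <= Num.sqrt m%:R `^ a.
Proof.
move=> a0; pose T1 := `|T| + 1; have T10 : 0 < T1 by rewrite ltr_wpDl.
exists (Num.truncn ((T1 `^ a^-1) ^+ 2)).+1 => m mT.
have h : T1 `^ a^-1 <= Num.sqrt m%:R.
  rewrite -[leLHS]ger0_norm ?powR_ge0// -sqrtr_sqr ler_sqrt// ltW//.
  by rewrite (lt_le_trans (truncnS_gt _))// ler_nat.
rewrite (@le_trans _ _ T1)//; first by rewrite (le_trans (ler_norm _))// lerDl.
rewrite -[leLHS]powRr1 ?(ltW T10)// -[X in _ `^ X <= _](mulVf (lt0r_neq0 a0)) powRrM.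
by apply: (ge0_ler_powR (ltW a0)); rewrite ?nnegrE ?powR_ge0 ?sqrtr_ge0.
Qed.

Local Notation theta s := (1 - (1 + 2 * s)^-1).

Lemma theta_gt0 s : 0 < s -> 0 < theta s.
Proof. by move=> s0; rewrite subr_gt0 invf_lt1; lra. Qed.

Lemma theta_lt s s' : 0 < s -> s < s' -> theta s < theta s'.
Proof. by move=> s0 ss; rewrite ltrD2l ltrN2 ltf_pV2 ?posrE; lra. Qed.

(* With radius [r] and deviation [t] both of order [sqrt m ^ (- theta s)], the
   entropy [C * r ^ (- 1 / s)] and the Chernoff exponent [m * t ^ 2] are both of
   order [sqrt m ^ (2 / (1 + 2 * s))]. *)
Lemma entropy_balance (K L C s : R) : 0 < K -> 0 < L -> 0 < C -> 0 < s ->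
  exists2 Gamma, 0 < Gamma & forall tau, exists m0, forall m, (m0 <= m)%N ->
    let r := Num.sqrt m%:R `^ (- theta s) in
    exists t, [/\ (0 < m)%N, 0 < r, 0 < t, t <= K &
      2 * t + 8 * L * r <= Gamma * r /\
      forall n, ln n%:R <= C * r `^ (- s^-1) ->
        n%:R * (2 * expR (- (m%:R * t ^+ 2 / (32 * K ^+ 2)))) <= expR (- tau)].
Proof.
move=> K0 L0 C0 s0; have th0 := theta_gt0 s s0.
have s12 : 0 < 1 + 2 * s by lra.
(* With t = g r the Chernoff exponent is (C + 1) x^b, where x = sqrt m. It exceeds the entropy C x^b
   by x^b, which for large [m] is at least 1 + tau; the 1 pays for the factor 2, as 2 <= exp 1. *)
pose g := Num.sqrt (32 * K ^+ 2 * (C + 1)).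
have K2 : 0 < 32 * K ^+ 2 by rewrite mulr_gt0// exprn_gt0.
have g0 : 0 < g by rewrite sqrtr_gt0 mulr_gt0// addr_gt0.
exists (2 * g + 8 * L); first by rewrite addr_gt0// mulr_gt0.
move=> tau; pose b := 2 / (1 + 2 * s).
have b0 : 0 < b by rewrite divr_gt0.
have [m1 m1P] := powR_sqrt_unbounded b (1 + tau) b0.
have [m2 m2P] := powR_sqrt_unbounded (theta s) (g / K) th0.
exists (maxn 1 (maxn m1 m2)) => m; rewrite !geq_max => /and3P[m0 /m1P nu_ge /m2P x_ge].
move=> r; exists (g * r).
have mR : 0 < m%:R :> R by rewrite ltr0n.
set x := Num.sqrt m%:R in r nu_ge x_ge *.
have x0 : 0 < x by rewrite sqrtr_gt0.
have r0 : 0 < r by exact: powR_gt0.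
split => //; first by rewrite mulr_gt0.
  rewrite /r powRN -ler_pdivlMr ?invr_gt0 ?powR_gt0// invrK mulrC.
  by rewrite -ler_pdivrMr.
split; first by lra.
have rE : r `^ (- s^-1) = x `^ b.
  rewrite /r -powRrM; congr (_ `^ _); rewrite /b; field.
  by rewrite !gt_eqF.
have mE : m%:R * (g * r) ^+ 2 / (32 * K ^+ 2) = (C + 1) * x `^ b.
  have -> : x `^ b = m%:R * r ^+ 2.
    rewrite -[m%:R]sqr_sqrtr ?ltW// -/x.
    rewrite -(powR_mulrn 2 (ltW x0)) -(powR_mulrn 2 (ltW r0)) /r -powRrM.
    rewrite -powRD ?(gt_eqF x0) ?implybT//.
    by congr (_ `^ _); rewrite /b; field; rewrite gt_eqF.
  rewrite exprMn /g sqr_sqrtr; last by rewrite ltW// mulr_gt0// addr_gt0.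
  by field; rewrite gt_eqF.
move=> n; rewrite rE mE => ln_le.
have [->|n0] := eqVneq n 0%N; first by rewrite mul0r expR_ge0.
have nR : 0 < n%:R :> R by rewrite ltr0n lt0n.
rewrite -[n%:R]lnK ?posrE//.
apply: (@le_trans _ _ (expR (C * x `^ b) * (expR 1 * expR (- ((C + 1) * x `^ b))))).
  apply: ler_pM; rewrite ?expR_ge0 ?mulr_ge0 ?expR_ge0 ?ler_expR//.
  by rewrite ler_wpM2r ?expR_ge0//; have := expR_ge1Dx (1 : R); rewrite -natr1.
rewrite -!expRD ler_expR; lra.
Qed.

(** The strictly larger exponent gains a positive power of sqrt m, which eventually exceeds any
    [Gamma]; 1 <= a keeps the power of [a] above 1. *)
Lemma rate_le_slower s s' (a Gamma : R) : 0 < s -> s < s' -> 1 <= a ->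
  exists m0, forall m, (m0 <= m)%N ->
    Gamma * Num.sqrt m%:R `^ (- theta s') <= (a / Num.sqrt m%:R) `^ theta s.
Proof.
move=> s0 ss a1; have s'0 := lt_trans s0 ss.
have th0 := theta_gt0 s s0.
have d0 : 0 < theta s' - theta s by rewrite subr_gt0 theta_lt.
have [m1 m1P] := powR_sqrt_unbounded _ Gamma d0.
exists (maxn 1 m1) => m; rewrite geq_max => /andP[m0 /m1P].
set x := Num.sqrt m%:R; have x0 : 0 < x by rewrite sqrtr_gt0 ltr0n.
move=> Gx; rewrite powRM ?invr_ge0 ?(ltW x0) ?(le_trans ler01 a1)//.
rewrite -[x^-1]powR_inv1 ?(ltW x0)// -powRrM mulN1r.
rewrite (@le_trans _ _ (x `^ (theta s' - theta s) * x `^ (- theta s')))//.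
  by rewrite ler_wpM2r// powR_ge0.
rewrite -powRD ?(gt_eqF x0) ?implybT// addrAC subrr add0r.
rewrite ler_peMl ?powR_ge0// -[leLHS](powRr0 a) ler_powR// ltW//.
Qed.

(** With equal exponents nothing is gained as [m] grows, so [Gamma] has to be absorbed in [a]. *)
Lemma rate_le_same s (a Gamma : R) m : 0 < s -> 0 < Gamma ->
  Gamma `^ (theta s)^-1 <= a -> (0 < m)%N ->
  Gamma * Num.sqrt m%:R `^ (- theta s) <= (a / Num.sqrt m%:R) `^ theta s.
Proof.
move=> s0 G0 Ga m0; have th0 := theta_gt0 s s0.
have a0 : 0 <= a by rewrite (le_trans _ Ga)// powR_ge0.
set x := Num.sqrt m%:R; have x0 : 0 < x by rewrite sqrtr_gt0 ltr0n.
rewrite powRM ?invr_ge0 ?(ltW x0)// -[x^-1]powR_inv1 ?(ltW x0)// -powRrM mulN1r.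
rewrite ler_wpM2r ?powR_ge0//.
rewrite -[leLHS]powRr1 ?(ltW G0)// -[X in _ `^ X <= _](mulVf (lt0r_neq0 th0)) powRrM.
by apply: (ge0_ler_powR (ltW th0)); rewrite ?nnegrE ?powR_ge0.
Qed.

End rates.

(** * Covariance operators and the choice of the constants *)

Lemma covariance_symmetric {R : realType} {d : measure_display}
    {Omega : measurableType d} (P : probability Omega R) (Y : hilbertType R)
    (eps : Omega -> Y) (Sigma : bop Y Y) :
  is_covariance_operator P eps Sigma ->
  forall u v, inner (Sigma u) v = inner u (Sigma v).
Proof.
move=> cov u v; rewrite [RHS]innerC; apply: EFin_inj.
by rewrite -!cov covarianceC.
Qed.

Lemma covariance_ge0 {R : realType} {d : measure_display}
    {Omega : measurableType d} (P : probability Omega R) (Y : hilbertType R)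
    (eps : Omega -> Y) (Sigma : bop Y Y) :
  is_covariance_operator P eps Sigma -> forall u, 0 <= inner (Sigma u) u.
Proof. by move=> cov u; rewrite -lee_fin -cov; exact: variance_ge0. Qed.

Theorem corollary3p3 (R : realType) (X Y : hilbertType R)
    (sepX : separable X) (sepY : separable Y)
    (A : bop X Y) (Sigma : bop Y Y) (Bset : set (bop (l2 R) X)) (Q0 : R)
    (Sigma_inj : injective Sigma)
    (A_Sigma : range A `<=` range Sigma)
    (A_Sigma_compact : compact_operator (fun x => op_inv Sigma (A x)))
    (Bset_neq0 : Bset !=set0) (Bset_compact : compact Bset)
    (Bset_fbi : forall B, Bset B -> finite_basis_injective (A \o B))
    (Q0_gt0 : 0 < Q0) :
  exists alpha1 alpha2 : R, [/\ 0 < alpha1, 0 < alpha2 &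
  forall (C s : R), 0 < C -> 0 < s ->
    (forall r : R, 0 < r ->
      ln (covering_number Bset r)%:R <= C * r `^ (- s^-1)) ->
  forall (d : measure_display) (Omega : measurableType d)
    (P : probability Omega R) (x : Omega -> X) (eps : Omega -> Y)
    (rho : probability (borel X * borel Y)%type R),
    square_integrable P x -> square_integrable P eps ->
    zero_mean P eps -> is_covariance_operator P eps Sigma ->
    independent_rv P x eps ->
    {ae P, forall w, `|x w| <= Q0} -> {ae P, forall w, `|eps w| <= Q0} ->
    has_law P (fun w => (x w, A (x w) + eps w) : borel X * borel Y) rho ->
  forall Bstar, minimizes (risk A Sigma rho) Bset Bstar ->
  forall tau : R, 0 < tau ->
  exists m0 : nat, forall m : nat, (m0 <= m)%N ->
  forall (d' : measure_display) (Omega' : measurableType d')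
    (P' : probability Omega' R) (z : 'I_m -> Omega' -> borel X * borel Y),
    iid_sample P' z rho ->
  forall Bhat : Omega' -> bop (l2 R) X,
    {ae P', forall w,
      minimizes (empirical_risk A Sigma (fun j => z j w)) Bset (Bhat w)} ->
  exists E : set Omega', [/\ measurable E,
    E `<=` [set w |
      (risk A Sigma rho (Bhat w) - risk A Sigma rho Bstar
       <= (((alpha1 + alpha2 * Num.sqrt tau) / Num.sqrt m%:R)
             `^ (1 - (1 + 2 * s)^-1))%:E)%E]
    & ((1 - expR (- tau))%:E <= P' E)%E]].
Proof.
(* Symmetry and positivity follow from the covariance hypothesis, which comes only after the
   constants. If they fail, no noise has covariance [Sigma] and any constants will do. *)
pose Sigma_ok := (forall u v, inner (Sigma u) v = inner u (Sigma v)) /\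
  (forall u, 0 <= inner (Sigma u) u).
have [[Sigma_sym Sigma_ge0]|nok] := pselect Sigma_ok; last first.
  exists 1, 1; split => // C s _ _ _ d Omega P x eps rho _ _ _ cov.
  by case: nok; split; [exact: covariance_symmetric cov|exact: covariance_ge0 cov].
have [K [L [K0 L0 bound]]] := excess_risk_bound A Sigma Bset Q0 sepX Sigma_inj Sigma_sym
  Sigma_ge0 A_Sigma A_Sigma_compact Bset_compact Bset_fbi Q0_gt0.
pose valid s := 0 < s /\ exists2 C, 0 < C & forall r : R, 0 < r ->
  ln (covering_number Bset r)%:R <= C * r `^ (- s^-1).
(* The rate improves strictly with [s], so a constant depending on [C] is harmless
   for large [m] unless [s] is the largest valid exponent; in that case it can
   be absorbed in [alpha1], as it is then determined by [Bset]. *)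
have [alpha1 alpha1_ge1 alphaP] : exists2 alpha1 : R, 1 <= alpha1 &
    forall s, valid s -> exists s' Gamma C, [/\
      (forall r : R, 0 < r -> ln (covering_number Bset r)%:R <= C * r `^ (- s'^-1)),
      (forall tau, exists m0, forall m, (m0 <= m)%N ->
        let r := Num.sqrt m%:R `^ (- (1 - (1 + 2 * s')^-1)) in
        exists t, [/\ (0 < m)%N, 0 < r, 0 < t, t <= K &
          2 * t + 8 * L * r <= Gamma * r /\
          forall n, ln n%:R <= C * r `^ (- s'^-1) ->
            n%:R * (2 * expR (- (m%:R * t ^+ 2 / (32 * K ^+ 2)))) <= expR (- tau)])
      & forall a : R, alpha1 <= a -> exists m0, forall m, (m0 <= m)%N ->
        Gamma * Num.sqrt m%:R `^ (- (1 - (1 + 2 * s')^-1))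
        <= (a / Num.sqrt m%:R) `^ (1 - (1 + 2 * s)^-1)].
  have [[s0 [vs0 s0max]]|nomax] := pselect (exists s0, valid s0 /\
      forall s, valid s -> s <= s0).
    have [s00 [C C0 CP]] := vs0.
    have [Gamma G0 GP] := entropy_balance K L C s0 K0 L0 C0 s00.
    exists (Num.max 1 (Gamma `^ (1 - (1 + 2 * s0)^-1)^-1)); first by rewrite le_max lexx.
    move=> s vs; exists s0, Gamma, C; split => // a.
    rewrite ge_max => /andP[a1 aG].
    have := s0max s vs; rewrite le_eqVlt => /predU1P[->|ss0].
      by exists 1%N => m m0; exact: rate_le_same.
    exact: (rate_le_slower s s0 a Gamma vs.1 ss0 a1).
  (* Without a largest valid exponent, every valid [s] is strictly below another one, whose faster
     rate absorbs all constants. *)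
  exists 1 => // s vs.
  have [s' vs' ss'] : exists2 s', valid s' & s < s'.
    apply: contrapT => no; apply: nomax; exists s; split => // s' vs'.
    by rewrite leNgt; apply/negP => ss'; apply: no; exists s'.
  have [s'0 [C C0 CP]] := vs'.
  have [Gamma G0 GP] := entropy_balance K L C s' K0 L0 C0 s'0.
  exists s', Gamma, C; split => // a a1.
  exact: (rate_le_slower s s' a Gamma vs.1 ss' a1).
(* [tau] acts through the threshold on [m] alone; the term with sqrt tau only enlarges the bound, so
   [alpha2] can be 1. *)
exists alpha1, 1; split => //; first exact: lt_le_trans alpha1_ge1.
move=> C s C0 s0 cover d Omega P x eps rho _ _ _ _ _ xQ epsQ xlaw Bstar [BBstar _].
move=> tau tau0.
have vs : valid s by split => //; exists C.
have [s' [Gamma [C' [cover' rateP compareP]]]] := alphaP s vs.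
have [m1 m1P] := rateP tau.
have [|m2 m2P] := compareP (alpha1 + 1 * Num.sqrt tau).
  by rewrite mul1r lerDl sqrtr_ge0.
exists (maxn m1 m2) => m; rewrite geq_max => /andP[/m1P/= [t [m0 r0 t0 tK [tr small]]] /m2P rate].
move=> d' Omega' P' z zrho Bhat Bhatmin.
set r := Num.sqrt m%:R `^ _ in r0 tr small rate.
have [E [mE Ele PE]] := bound d Omega P x eps rho xQ epsQ xlaw t r
  (covering_number Bset r) t0 tK (covering_number_covered Bset r Bset_compact r0)
  d' Omega' P' m z m0 zrho Bhat Bstar BBstar Bhatmin.
exists E; split => //.
  move=> w /Ele/= /le_trans; apply; rewrite lee_fin.
  exact: (le_trans tr rate).
rewrite (le_trans _ PE)// lee_fin lerD2l lerN2.
by apply: small; exact: cover'.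
Qed.
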